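(* Let $\mathcal{H}$ be an essential hyperplane arrangement in a finite-dimensional $\mathbb{K}$-vector space $V$ and let $E_{\mathcal{H}}$ be a reflexive model of $\mathcal{H}$ (a $\mathbb{Z}^n$-graded finitely generated reflexive $S$-module for some $n$). For $X\in\mathcal{H}$ let $\underline{c}^X\in\mathbb{Z}^n$ be the image of $X$ under the poset embedding of $\mathcal{H}$ into $\mathbb{Z}^n$. Then the graded Betti number $\beta_i(\underline{c}^X)$ of $E_{\mathcal{H}}$ is zero unless $\dim X=i+1$. If $\dim X=i+1$, then $\beta_i(\underline{c}^X)$ coincides with the beta invariant $\beta^X$ of $X$.
   Context: $\mathbb{K}$ is a field, $S=\mathbb{K}[x_1,\dots,x_n]$ with its standard $\mathbb{Z}^n$-grading, $[n]=\{1,\dots,n\}$. Reflexive modules: finitely generated $\mathbb{Z}^n$-graded reflexive $S$-modules $E$ correspond (Klyachko) to finite-dimensional vector spaces $\mathbf{E}$ with $n$ increasing filtrations $E^k(i)$ ($k\in[n]$, $i\in\mathbb{Z}$), $E^k(i)=0$ for $i\ll0$, $E^k(i)=\mathbf{E}$ for $i\gg0$, where $\mathbf{E}$ is the colimit of the graded components and $E_{\underline{c}}=\bigcap_kE^k(c_k)$. For each $k$ let $i^k_1<\cdots<i^k_{t_k}$ be the integers $i$ with $E^k(i-1)\subsetneq E^k(i)$; $\mathcal{V}_E$ is the set of all intersections of the subspaces $E^k(i^k_j)$. A hyperplane arrangement generated by finitely many hyperplanes $H_1,\dots,H_t$ of $V$ is identified with the set $\mathcal{H}$ of all intersections of the $H_l$,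 including $V$ (the empty intersection), partially ordered by inclusion ($X\le Y$ iff $X\subseteq Y$). It is essential if $\bigcap_lH_l=0$. A reflexive module $E$ is a reflexive model for $\mathcal{H}$ if there is a vector space isomorphism $\mathbf{E}\to V$ which induces an identification $\mathcal{V}_E\cong\mathcal{H}$. The poset embedding is $X\mapsto\underline{c}^X=(c^X_1,\dots,c^X_n)$, $c^X_k=\min\{i^k_j\mid X\subseteq E^k(i^k_j)\}$ (identifying $V$ with $\mathbf{E}$). The graded Betti numbers $\beta_i(\underline{c})$ are defined by the minimal $\mathbb{Z}^n$-graded free resolution with $F_i\cong\bigoplus_{\underline{c}}S(-\underline{c})^{\beta_i(\underline{c})}$. The Möbius function of $\mathcal{H}$ is given by $\mu(X,X)=1$, $\mu(X,Y)=-\sum_{X\le Z<Y}\mu(X,Z)$ for $X<Y$, and $\mu(X,Y)=0$ otherwise. For $X\in\mathcal{H}$ the beta invariant is $$\beta^X=(-1)^{\dim X-1}\sum_{Y\in\mathcal{H},\,Y\le X}\dim(Y)\,\mu(Y,X).$$ *)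

(* Defs.v *)
From mathcomp Require Import all_boot all_order all_algebra.
From mathcomp Require Import mpoly.

Set Implicit Arguments.
Unset Strict Implicit.
Unset Printing Implicit Defensive.

Import GRing.Theory.
Local Open Scope ring_scope.

(** * Z^n-graded modules over S = K[x_1, ..., x_n] *)

Notation Zn n := {ffun 'I_n -> int}.

Section GradedModules.
Variables (K : fieldType) (n : nat).
Local Notation S := {mpoly K[n]}.

Definition mnm_deg (m : 'X_{1..n}) : Zn n := [ffun k => (m k)%:Z].

Definition S_homog (d : Zn n) (p : S) : Prop :=
  forall m, m \in msupp p -> mnm_deg m = d.

(* [gr c] is the component of degree c; the last two fields together say that
   the module is the (internal) direct sum of its components. *)
Record gmod := Gmod {
  gsort :> lmodType S;
  gr : Zn n -> gsort -> Prop;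
  gr0 : forall c, gr c 0;
  grD : forall c u v, gr c u -> gr c v -> gr c (u + v);
  grZ : forall d c p u, S_homog d p -> gr c u -> gr (d + c) (p *: u);
  gr_decomp : forall u, exists (s : seq (Zn n)) (f : Zn n -> gsort),
    [/\ uniq s, forall c, gr c (f c) & u = \sum_(c <- s) f c];
  gr_direct : forall (s : seq (Zn n)) (f : Zn n -> gsort),
    uniq s -> (forall c, gr c (f c)) -> \sum_(c <- s) f c = 0 ->
    forall c, c \in s -> f c = 0
}.

Definition fin_generated (M : gmod) : Prop :=
  exists (r : nat) (g : 'I_r -> M),
    forall u : M, exists a : 'I_r -> S, u = \sum_(j < r) a j *: g j.

(* The evaluation map M -> Hom_S(Hom_S(M, S), S) is bijective; the S-module
   structure of Hom_S(M, S) is spelled out pointwise. *)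
Definition dual_linear (M : gmod) (phi : {scalar M} -> S) : Prop :=
  forall (a : S) (f g h : {scalar M}),
    (forall u, h u = a * f u + g u) -> phi h = a * phi f + phi g.

Definition reflexive_module (M : gmod) : Prop :=
  (forall u : M, (forall f : {scalar M}, f u = 0) -> u = 0) /\
  (forall phi : {scalar M} -> S, dual_linear phi ->
     exists u : M, forall f, phi f = f u).

Definition graded_hom (M N : gmod) (f : {linear M -> N}) : Prop :=
  forall c u, gr c u -> gr c (f u).

Definition graded_iso (M N : gmod) : Prop :=
  exists f : {linear M -> N},
    bijective f /\ forall c u, gr c u <-> gr c (f u).

(** ** The graded free module S(-d_0) + ... + S(-d_(r-1)) *)

(* S(-d)_c = S_(c-d) *)
Definition free_gr (ds : seq (Zn n)) (c : Zn n) (u : 'rV[S]_(size ds)) : Prop :=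
  forall j, S_homog (c - tnth (in_tuple ds) j) (u 0 j).

Lemma S_homog0 d : S_homog d 0.
Proof. by move=> m; rewrite msupp0. Qed.

Lemma S_homogD d p q : S_homog d p -> S_homog d q -> S_homog d (p + q).
Proof.
move=> hp hq m /msuppD_le; rewrite mem_cat => /orP [/hp|/hq] //.
Qed.

Lemma mnm_degD m1 m2 : mnm_deg (m1 + m2) = mnm_deg m1 + mnm_deg m2.
Proof. by apply/ffunP => k; rewrite !ffunE mnmDE PoszD. Qed.

Lemma S_homogM d e p q : S_homog d p -> S_homog e q -> S_homog (d + e) (p * q).
Proof.
move=> hp hq m /msuppM_le /allpairsP [[m1 m2] /= [/hp <- /hq <- ->]].
exact: mnm_degD.
Qed.

Section Free.
Variable ds : seq (Zn n).
Local Notation F := 'rV[S]_(size ds).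
Local Notation dg j := (tnth (in_tuple ds) j).

Lemma free_gr0 c : @free_gr ds c 0.
Proof. by move=> j; rewrite mxE; apply: S_homog0. Qed.

Lemma free_grD c (u v : F) :
  free_gr c u -> free_gr c v -> free_gr c (u + v).
Proof. by move=> hu hv j; rewrite mxE; apply: S_homogD. Qed.

Lemma free_grZ d c (p : S) (u : F) :
  S_homog d p -> free_gr c u -> free_gr (d + c) (p *: u).
Proof. by move=> hp hu j; rewrite mxE -addrA; apply: S_homogM. Qed.

Lemma free_gr_decomp (u : F) : exists (s : seq (Zn n)) (f : Zn n -> F),
  [/\ uniq s, forall c, free_gr c (f c) & u = \sum_(c <- s) f c].
Proof.
pose f c : F := \row_j \sum_(m <- msupp (u 0 j) | mnm_deg m + dg j == c)
                          (u 0 j)@_m *: 'X_[m].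
pose s := undup (flatten [seq [seq mnm_deg m + dg j | m <- msupp (u 0 j)]
                         | j <- enum 'I_(size ds)]).
exists s, f; split; first exact: undup_uniq.
  move=> c j; rewrite mxE; elim/big_rec: _ => [|m p /eqP em hp].
    exact: S_homog0.
  apply: S_homogD hp => m' /msuppZ_le; rewrite msuppX inE => /eqP ->.
  by rewrite -em addrK.
apply/rowP => j; rewrite summxE [LHS]mpolyE.
under [RHS]eq_bigr => c _ do rewrite mxE big_mkcond /=.
rewrite exchange_big /= big_seq [RHS]big_seq; apply: eq_bigr => m hm.
rewrite (bigD1_seq (mnm_deg m + dg j)) ?undup_uniq //=; last first.
  rewrite mem_undup; apply/flatten_mapP; exists j; first by rewrite mem_enum.
  by apply/mapP; exists m.
by rewrite eqxx big1 ?addr0 // => c; rewrite eq_sym => /negPf ->.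
Qed.

Lemma free_gr_direct (s : seq (Zn n)) (f : Zn n -> F) :
  uniq s -> (forall c, free_gr c (f c)) -> \sum_(c <- s) f c = 0 ->
  forall c, c \in s -> f c = 0.
Proof.
move=> us hf hs c cs; apply/rowP => j; rewrite mxE; apply/mpolyP => m.
have := congr1 (fun w : F => (w 0 j)@_m) hs.
rewrite summxE mxE raddf_sum /= mcoeff0.
have [hm|hm _] := boolP (m \in msupp (f c 0 j)); last exact: memN_msupp_eq0.
rewrite (bigD1_seq c) //= big1 ?addr0 // => c' ne.
apply: memN_msupp_eq0; apply: contra ne => /hf e'.
by rewrite -[c'](subrK (dg j)) -[c](subrK (dg j)) -e' (hf _ _ _ hm).
Qed.

Definition free_gmod : gmod :=
  Gmod free_gr0 free_grD free_grZ free_gr_decomp free_gr_direct.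

End Free.

(** ** Minimal graded free resolutions and graded Betti numbers *)

(* u lies in (x_1, ..., x_n) M *)
Definition in_max_ideal_mul (M : gmod) (u : M) : Prop :=
  exists v : 'I_n -> M, u = \sum_(k < n) 'X_k *: v k.

(* ... -> F 2 -> F 1 -> F 0 -> M -> 0 with [d i : F (i+1) -> F i]. *)
Definition minimal_graded_resolution (M : gmod) (F : nat -> gmod)
    (d : forall i, {linear F i.+1 -> F i}) (eps : {linear F 0%N -> M}) : Prop :=
  [/\ graded_hom eps /\ (forall i, graded_hom (d i)),
      forall w : M, exists u, eps u = w,
      forall u, eps u = 0 <-> (exists w, d 0%N w = u),
      forall i u, d i u = 0 <-> (exists w, d i.+1 w = u)
    & forall i u, in_max_ideal_mul (d i u)].

(* M is isomorphic to the direct sum of the S(-c)^(b c) *)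
Definition graded_free (M : gmod) (b : Zn n -> nat) : Prop :=
  exists ds : seq (Zn n),
    (forall c, b c = count_mem c ds) /\ graded_iso M (free_gmod ds).

Definition graded_betti (M : gmod) (b : nat -> Zn n -> nat) : Prop :=
  exists (F : nat -> gmod) (d : forall i, {linear F i.+1 -> F i})
         (eps : {linear F 0%N -> M}),
    minimal_graded_resolution d eps /\ (forall i, graded_free (F i) (b i)).

(** ** The limit vector space and its filtrations *)

(* Since M is the direct sum of its components, a cocone with vertex W on the
   diagram of the M_c and the multiplications M_c -> M_(c + e_k) by x_k amounts
   to a K-linear map M -> W that is invariant under multiplication by each x_k. *)
Definition is_cocone (M : gmod) (W : lmodType K) (g : M -> W) : Prop :=
  [/\ forall u v, g (u + v) = g u + g v,
      forall (a : K) u, g (a%:MP *: u) = a *: g u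
    & forall (k : 'I_n) u, g ('X_k *: u) = g u].

Definition is_colimit (M : gmod) (bE : lmodType K) (iota : M -> bE) : Prop :=
  is_cocone iota /\
  forall (W : lmodType K) (g : M -> W), is_cocone g ->
    (exists h : {linear bE -> W}, forall u, h (iota u) = g u) /\
    (forall h1 h2 : {linear bE -> W},
       (forall u, h1 (iota u) = g u) -> (forall u, h2 (iota u) = g u) ->
       h1 =1 h2).

(* E^k(i) is the union in bE of the images of the M_c with c_k = i, i.e. the
   image of the colimit of these components. *)
Definition is_klyachko_filtration (M : gmod) (bE : vectType K) (iota : M -> bE)
    (Ef : 'I_n -> int -> {vspace bE}) : Prop :=
  forall k i v,
    v \in Ef k i <-> exists (c : Zn n) (u : M), [/\ c k = i, gr c u & iota u = v].

Section Filtrations.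
Variables (bE : vectType K) (Ef : 'I_n -> int -> {vspace bE}).

Definition is_jump (k : 'I_n) (i : int) : Prop :=
  (Ef k (i - 1) <= Ef k i)%VS /\ Ef k (i - 1) <> Ef k i.

(* The empty intersection is allowed; for n > 0 and bE <> 0 it adds nothing,
   as bE is itself the last step of each filtration. *)
Definition in_VE (U : {vspace bE}) : Prop :=
  exists s : seq ('I_n * int),
    (forall p, p \in s -> is_jump p.1 p.2) /\ U = (\bigcap_(p <- s) Ef p.1 p.2)%VS.

End Filtrations.
End GradedModules.

(** * Hyperplane arrangements *)

Section Arrangements.
Variables (K : fieldType) (V : vectType K) (t : nat) (H : 'I_t -> {vspace V}).

Definition hyperplanes : Prop := forall l, (\dim (H l)).+1 = \dim {:V}.

Definition essential : Prop := (\bigcap_(l < t) H l)%VS = 0%VS.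

Definition flats : seq {vspace V} :=
  undup [seq (\bigcap_(l in A) H l)%VS | A : {set 'I_t}].

(* The Moebius function by its recursion; as Z < Y implies dim Z < dim Y, the
   fuel (dim Y) + 1 suffices, see [mobius_lt]. *)
Fixpoint mobius_rec (fuel : nat) (X Y : {vspace V}) : int :=
  if fuel is k.+1 then
    if X == Y then 1
    else if (X <= Y)%VS then
      - \sum_(Z <- flats | [&& X <= Z, Z <= Y & Z != Y]%VS) mobius_rec k X Z
    else 0
  else 0.

Definition mobius (X Y : {vspace V}) : int := mobius_rec (\dim Y).+1 X Y.

Lemma mobius_rec_fuel a b X Y : (\dim Y < a)%N -> (\dim Y < b)%N ->
  mobius_rec a X Y = mobius_rec b X Y.
Proof.
elim: a b Y => [//|a IH] [//|b] Y /= ha hb.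
case: ifP => // _; case: ifP => // _; congr (- _).
apply: eq_bigr => Z /and3P [_ ZY nZY].
have lt : (\dim Z < \dim Y)%N.
  by rewrite ltn_neqAle dimvS // andbT; apply: contraNneq nZY => e;
     rewrite eqEdim ZY e leqnn.
by apply: IH; apply: leq_trans lt _.
Qed.

Lemma mobius_refl X : mobius X X = 1.
Proof. by rewrite /mobius /= eqxx. Qed.

Lemma mobius_lt X Y : (X <= Y)%VS -> X != Y ->
  mobius X Y = - \sum_(Z <- flats | [&& X <= Z, Z <= Y & Z != Y]%VS) mobius X Z.
Proof.
move=> XY nXY; rewrite {1}/mobius /= (negPf nXY) XY; congr (- _).
apply: eq_bigr => Z /and3P [_ ZY nZY]; apply: mobius_rec_fuel => //.
by rewrite ltn_neqAle dimvS // andbT; apply: contraNneq nZY => e;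
   rewrite eqEdim ZY e leqnn.
Qed.

Lemma mobius_nle X Y : ~~ (X <= Y)%VS -> mobius X Y = 0.
Proof.
move=> nXY; rewrite /mobius /= (negPf nXY).
by case: eqP nXY => // ->; rewrite subvv.
Qed.

(* For dim X = 0 the sum vanishes, so the truncation in the exponent is
   harmless. *)
Definition beta_invariant (X : {vspace V}) : int :=
  (-1) ^+ (\dim X).-1 *
  \sum_(Y <- flats | (Y <= X)%VS) (\dim Y)%:Z * mobius Y X.

(** * Reflexive models and the poset embedding *)

Variables (n : nat) (bE : vectType K) (Ef : 'I_n -> int -> {vspace bE}).

Definition identifies_flats (phi : 'Hom(bE, V)) : Prop :=
  [/\ lker phi = 0%VS, limg phi = fullv
    & forall X : {vspace V}, X \in flats <->
        exists U : {vspace bE}, in_VE Ef U /\ X = (phi @: U)%VS].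

(* c is the image of X under the poset embedding: c_k is the least jump i of
   the k-th filtration with X contained in E^k(i). *)
Definition is_poset_embedding (phi : 'Hom(bE, V)) (X : {vspace V}) (c : Zn n)
    : Prop :=
  forall k,
    [/\ is_jump Ef k (c k), (X <= phi @: Ef k (c k))%VS
      & forall i, is_jump Ef k i -> (X <= phi @: Ef k i)%VS -> (c k <= i)%R].

End Arrangements.

(* Main.v *)
Require Import Defs.
From HB Require Import structures.
From mathcomp Require Import all_boot all_order all_algebra.
From mathcomp Require Import mpoly.
From mathcomp Require Import zify ring.
From Stdlib Require Import IndefiniteDescription.
Local Open Scope ring_scope.
Set Implicit Arguments.
Unset Strict Implicit.
Unset Printing Implicit Defensive.
Import GRing.Theory Order.TTheory Num.Theory.

(** The graded Betti number [beta i c] is the dimension of [Tor_i(E, K)] in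
    degree [c].  To compute it without double complexes, consider more
    generally, for sets [A], [B] of variables, the number
    [h i A B = dim Tor_i(E, S / (x_k : k in A))] in degree [c - e_B], where
    [e_B] is the sum of the [e_k] for [k] in [B]: it is the homology in degree
    [i] of the given resolution modulo the variables in [A].  Multiplication by
    [x_k] yields a long exact sequence of the spaces with these dimensions,
    [... -> h i A (k |: B) -> h i A B -> h i (k |: A) B -> h i.-1 A (k |: B)];
    [h i set0 B] vanishes for [i > 0] because the resolution is exact, and
    [h 0 A B] is the dimension of a quotient of [U B = E_(c - e_B)], viewed in
    the limit space.  These three facts ([koszul_numbers]) are all that is
    needed about [E]; minimality gives [beta i c = h i setT set0]
    ([tor_betti]).

    Since [E] is reflexive, [E_c] is the intersection of the filtration spaces
    [E^k(c_k)] ([klyachko_cspace]).  For the degree of a flat [X], this makes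
    [U set0 = X], and the [U [set k]] are flats strictly below [X] (when
    [X <> 0]) among which all hyperplanes of [X] occur.  For such a family:

    - a deletion-restriction induction with the long exact sequence shows that
      [h i setT set0] vanishes unless [dim X = i + 1]
      ([koszul_concentration]).  A member of the family contained in another
      one can be dropped, a member transversal to the intersection of other
      members kills all numbers ([koszul_coloop]), and otherwise deletion
      and restriction are concentrated in the expected degrees;

    - additivity of Euler characteristics makes the only surviving number,
      up to sign, the sum of [(-1) ^ #|A| * dim (U A)] over all [A]
      ([koszul_euler]), and Rota's crosscut argument turns this into the sum of
      [dim Y * mu(Y, X)] over the flats [Y <= X] ([crosscut]).

    To work with finite dimensional vector spaces throughout, all variables are
    specialised to 1.  A graded free module becomes [K^r], its component of
    degree [c] becomes the coordinate subspace of the generators of degree at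
    most [c] ([coordinates]), and the resolution becomes a complex of the
    [K^r] that is exact on the subspaces of each degree. *)

(** * Relative homology of subcomplexes *)

Lemma addvCA (K : fieldType) (W : vectType K) (U1 U2 U3 : {vspace W}) :
  (U1 + (U2 + U3) = U2 + (U1 + U3))%VS.
Proof. by rewrite !addvA (addvC U1). Qed.

Section RelativeHomology.
Variables (K : fieldType) (W : nat -> vectType K).
Variable del : forall i, 'Hom(W i.+1, W i).
Implicit Types C P Q S I : forall i, {vspace W i}.

Definition subcomplex C := forall i, (del i @: C i.+1 <= C i)%VS.

(** [dim H_i(C / Q)] for subcomplexes [Q <= C] of [W]: relative cycles modulo
    relative boundaries. *)
Definition relhom C Q i : nat :=
  match i with
  | 0 => (\dim (C 0) - \dim (del 0 @: C 1 + Q 0))%N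
  | j.+1 => (\dim (C j.+1 :&: del j @^-1: Q j) -
             \dim (del j.+1 @: C j.+2 + Q j.+1))%N
  end.

Lemma dim_preim_rel (i : nat) (U : {vspace W i.+1}) (Q : {vspace W i}) :
  (\dim (U :&: lker (del i)) + \dim (del i @: U :&: Q) =
   \dim (U :&: del i @^-1: Q))%N.
Proof.
rewrite -(limg_ker_dim (del i) (U :&: del i @^-1: Q)); congr addn; apply: congr1.
  apply/vspaceP => v; rewrite !memv_cap -memv_preim memv_ker.
  by case: eqP => [->|]; rewrite ?mem0v ?andbT ?andbF.
apply/vspaceP => w; rewrite memv_cap; apply/andP/memv_imgP.
  case=> /memv_imgP [u uU ->] uQ; exists u => //.
  by rewrite memv_cap uU -memv_preim.
case=> u; rewrite memv_cap -memv_preim => /andP [uU uQ] ->.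
by rewrite memv_img.
Qed.

Lemma eq_relhom C Q Q' : (forall i, Q i = Q' i) ->
  forall i, relhom C Q i = relhom C Q' i.
Proof. by move=> QQ' [|i] /=; rewrite !QQ'. Qed.

Hypothesis del2 : forall i w, del i (del i.+1 w) = 0.

(** The long exact sequence of [0 -> P / (P :&: Q) -> C / Q -> C / (P + Q) -> 0],
    reduced to its numerical content: [r i] is the rank of the map from the
    first to the second homology in degree [i], and each dimension of the third
    splits into a cokernel and a kernel.  With [r] written as a difference of
    dimensions this is a consequence of the modular identities
    [dim (A + B) + dim (A :&: B) = dim A + dim B] and of rank-nullity. *)
Lemma relhom_les C P Q S I :
  subcomplex C -> subcomplex P -> subcomplex Q ->
  (forall i, P i <= C i)%VS -> (forall i, Q i <= C i)%VS ->
  (forall i, S i = P i + Q i)%VS -> (forall i, I i = P i :&: Q i)%VS ->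
  exists r : nat -> nat,
  [/\ forall i, (r i <= relhom C Q i)%N /\ (r i <= relhom P I i)%N,
      relhom C S 0 = (relhom C Q 0 - r 0%N)%N
    & forall i, relhom C S i.+1 =
        ((relhom C Q i.+1 - r i.+1) + (relhom P I i - r i))%N].
Proof.
move=> sC sP sQ PC QC eS eI.
suff [r [rle e0 e1]] : exists r : nat -> nat,
    [/\ forall i, (r i <= relhom C Q i)%N /\
                  (r i <= relhom P (fun i => P i :&: Q i)%VS i)%N,
        relhom C (fun i => P i + Q i)%VS 0 = (relhom C Q 0 - r 0%N)%N
      & forall i, relhom C (fun i => P i + Q i)%VS i.+1 =
          ((relhom C Q i.+1 - r i.+1) +
           (relhom P (fun i => P i :&: Q i)%VS i - r i))%N].
  by exists r; split=> [i||i]; rewrite ?(eq_relhom _ eS) ?(eq_relhom _ eI).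
(* [Z i] and [B i] are the cycles and boundaries of the whole complex modulo
   [Q]; intersecting with [C] or [P] gives those of [C / Q] and the image of
   [P / (P :&: Q)]. *)
pose Z i : {vspace W i} :=
  match i with 0 => fullv | j.+1 => (del j @^-1: Q j)%VS end.
pose B i := (del i @: C i.+1 + Q i)%VS.
have BC i : (B i <= C i)%VS by rewrite subv_add sC QC.
have BZ i : (B i <= Z i)%VS.
  case: i => [|i] /=; first exact: subvf.
  rewrite subv_add; apply/andP; split.
    apply/subvP => v /memv_imgP [w _ ->]; rewrite -memv_preim del2; exact: mem0v.
  by apply/subvP => v vQ; rewrite -memv_preim; apply: (subvP (sQ i)); exact: memv_img.
have hCQ i : relhom C Q i = (\dim (C i :&: Z i) - \dim (B i))%N.
  by case: i => [|i] //=; rewrite capvf.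
have hPQ i : relhom P (fun i => P i :&: Q i)%VS i =
    (\dim (P i :&: Z i) - \dim (del i @: P i.+1 + P i :&: Q i))%N.
  case: i => [|i] /=; first by rewrite capvf.
  congr subn; apply: congr1; apply/vspaceP => v; rewrite !memv_cap -!memv_preim memv_cap.
  by have [vP|//] := boolP (v \in P _); rewrite (subvP (sP i)) // memv_img.
have ledelPB i : (del i @: P i.+1 + P i :&: Q i <= P i :&: B i)%VS.
  rewrite subv_cap !subv_add sP capvSl /=.
  rewrite (subv_trans (limgS _ (PC _))) ?addvSl //.
  by rewrite (subv_trans (capvSr _ _)) ?addvSr.
have lePBZ i : (P i :&: B i <= P i :&: Z i)%VS by rewrite capvS.
exists (fun i => \dim (P i :&: Z i) - \dim (P i :&: B i))%N; split.
- move=> i; rewrite hCQ hPQ; split; last by rewrite leq_sub2l // dimvS.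
  have := dimv_sum_cap (P i :&: Z i) (B i).
  have -> : (P i :&: Z i :&: B i = P i :&: B i)%VS.
    by rewrite -capvA (capv_idPr (BZ i)).
  have : (\dim (P i :&: Z i + B i) <= \dim (C i :&: Z i))%N.
    apply: dimvS; rewrite subv_add !subv_cap BC BZ capvSr !andbT.
    exact: subv_trans (capvSl _ _) (PC i).
  have := dimvS (lePBZ i); lia.
- rewrite hCQ capvf /= capvf.
  have := dimv_sum_cap (P 0%N) (B 0%N).
  have -> : (P 0%N + B 0%N = del 0%N @: C 1%N + (P 0%N + Q 0%N))%VS by rewrite addvCA.
  have := dimvS (BC 0%N).
  have := dimvS (capvSl (P 0%N) (B 0%N)).
  have : (\dim (del 0%N @: C 1%N + (P 0%N + Q 0%N)) <= \dim (C 0%N))%N.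
    by apply: dimvS; rewrite !subv_add sC PC QC.
  lia.
- move=> i; rewrite hCQ hPQ /relhom.
  set N := (del i @: C i.+1)%VS.
  have e1 := dim_preim_rel (C i.+1) (P i + Q i).
  have e2 := dim_preim_rel (C i.+1) (Q i).
  have e3 := dim_preim_rel (P i.+1) (Q i).
  have e4 := limg_ker_dim (del i) (P i.+1).
  have e5 := dimv_sum_cap (P i.+1) (B i.+1).
  have -> : (del i.+1 @: C i.+2 + (P i.+1 + Q i.+1) = P i.+1 + B i.+1)%VS.
    by rewrite addvCA.
  have e6 := dimv_sum_cap (del i @: P i.+1) (P i :&: Q i).
  have e7 : (del i @: P i.+1 :&: (P i :&: Q i) = del i @: P i.+1 :&: Q i)%VS.
    by rewrite capvA (capv_idPl (sP i)).
  rewrite e7 in e6.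
  have e8 := dimv_sum_cap N (P i + Q i); have e9 := dimv_sum_cap N (Q i).
  have e10 := dimv_sum_cap (P i) (B i); have e11 := dimv_sum_cap (P i) (Q i).
  have e12 : (P i + B i = N + (P i + Q i))%VS by rewrite addvCA.
  rewrite e12 in e10.
  have l1 := dimvS (lePBZ i); have l2 := dimvS (lePBZ i.+1).
  have l3 := dimvS (ledelPB i).
  have l4 : (\dim (P i.+1 :&: Z i.+1 + B i.+1) <= \dim (C i.+1 :&: Z i.+1))%N.
    apply: dimvS; rewrite subv_add !subv_cap BC BZ capvSr !andbT.
    exact: subv_trans (capvSl _ _) (PC _).
  have l5 := dimv_sum_cap (P i.+1 :&: Z i.+1) (B i.+1).
  have e13 : (P i.+1 :&: Z i.+1 :&: B i.+1 = P i.+1 :&: B i.+1)%VS.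
    by rewrite -capvA (capv_idPr (BZ _)).
  rewrite e13 in l5.
  have l6 : (\dim (P i.+1 + B i.+1) <= \dim (C i.+1 :&: del i @^-1: (P i + Q i)))%N.
    apply: dimvS; rewrite subv_add !subv_cap PC BC /=; apply/andP; split.
      apply/subvP => v vP; rewrite -memv_preim; apply: (subvP (addvSl _ _)).
      by apply: (subvP (sP i)); exact: memv_img.
    apply: subv_trans (BZ i.+1) _; apply: lpreimS; exact: addvSr.
  have l7 := dimvS (capvSl (P i) (B i)).
  have l8 : (\dim (B i.+1) <= \dim (C i.+1 :&: Z i.+1))%N.
    by apply: dimvS; rewrite subv_cap BC BZ.
  rewrite /Z /B -/N in e1 e2 l1 l2 l3 l4 l5 l6 l7 l8 e5 e10 e11 e12 *.
  lia.
Qed.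

End RelativeHomology.

(** * Koszul numbers of a family of subspaces *)

Lemma set_ind (T : finType) (P : {set T} -> Prop) :
  P set0 -> (forall k (A : {set T}), k \notin A -> P A -> P (k |: A)) -> forall A, P A.
Proof.
move=> P0 PS A; have [m] := ubnP #|A|; elim: m A => // m IH A.
have [->//|[k kA]] := set_0Vmem A.
rewrite (cardsD1 k) kA ltnS => ltA.
by rewrite -(setD1K kA); apply: PS; rewrite ?setD11 //; apply: IH.
Qed.

Lemma big_subset_setU1 (T : finType) (R : zmodType) (k : T) (A : {set T})
    (F : {set T} -> R) : k \notin A ->
  \sum_(C : {set T} | C \subset k |: A) F C =
  \sum_(C : {set T} | C \subset A) F C +
  \sum_(C : {set T} | C \subset A) F (k |: C).
Proof.
move=> kA; rewrite (bigID (fun C : {set T} => k \notin C)) /=; congr (_ + _).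
  apply: eq_bigl => C; apply/andP/idP => [[CA kC]|CA].
    apply/subsetP => x xC; have := subsetP CA x xC.
    by rewrite !inE; case: eqP => // e; rewrite -e xC in kC.
  by rewrite subsetU ?CA ?orbT //; split=> //; apply: contra kA; apply: (subsetP CA).
rewrite (reindex_onto (fun C => k |: C) (fun C => C :\ k)) /=; last first.
  by move=> C /andP [_]; rewrite negbK; apply: setD1K.
apply: eq_bigl => C; rewrite negbK setU11 andbT; apply/andP/idP.
  move=> [CA /eqP eC]; have kC : k \notin C by rewrite -eC setD11.
  apply/subsetP => x xC; have /(subsetP CA) : x \in k |: C by rewrite !inE xC orbT.
  by rewrite !inE; case: eqP => // e; rewrite -e xC in kC.
move=> CA; rewrite setUS // setU1K //; apply: contra kA; exact: (subsetP CA).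
Qed.

Section KoszulNumbers.
Variables (K : fieldType) (V : vectType K) (T : finType).
Variables (U : {set T} -> {vspace V}) (h : nat -> {set T} -> {set T} -> nat).
Implicit Types (A B : {set T}) (i : nat) (j k : T).

(** The properties of the dimensions of the Koszul homology of the cube
    [C |-> U (B :|: C)], [C \subset A], from which they can be computed: the
    cokernel in degree 0, vanishing for the empty set of variables, and the
    ranks [r] of the long exact sequence that adds the variable [k]. *)
Definition koszul_numbers : Prop :=
  [/\ forall A B, h 0 A B = (\dim (U B) - \dim (\sum_(k in A) U (k |: B))%VS)%N,
      forall i B, h i.+1 set0 B = 0%N
    & forall A B k, exists r : nat -> nat,
      [/\ forall i, (r i <= h i A B)%N /\ (r i <= h i A (k |: B))%N,
          h 0 (k |: A) B = (h 0 A B - r 0)%N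
        & forall i, h i.+1 (k |: A) B =
                    ((h i.+1 A B - r i.+1) + (h i A (k |: B) - r i))%N]].

Hypothesis hU : forall A B, U (A :|: B) = (U A :&: U B)%VS.
Hypothesis hK : koszul_numbers.

Let h0 : forall A B,
  h 0 A B = (\dim (U B) - \dim (\sum_(k in A) U (k |: B))%VS)%N.
Proof. by case: hK. Qed.
Let hS i B : h i.+1 set0 B = 0%N. Proof. by case: hK. Qed.
Let les := let: And3 _ _ l := hK in l.

Let hU1 k B : U (k |: B) = (U [set k] :&: U B)%VS. Proof. exact: hU. Qed.

Let h00 B : h 0 set0 B = \dim (U B).
Proof. by rewrite h0 big_set0 dimv0 subn0. Qed.

Let h01 k B : h 0 [set k] B = (\dim (U B) - \dim (U (k |: B)))%N.
Proof. by rewrite h0 big_set1. Qed.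

Let mono A B : A \subset B -> (U B <= U A)%VS.
Proof. by move/setUidPl <-; rewrite hU capvSr. Qed.

Let le1 k B : (U (k |: B) <= U B)%VS. Proof. exact/mono/subsetUr. Qed.

Let hUU j k B : U (j |: (k |: B)) = (U (j |: B) :&: U (k |: B))%VS.
Proof. by rewrite -hU setUACA setUid -setUA. Qed.

Lemma koszul_vanish_cone A B k :
  (forall i, h i A B = 0%N) -> (forall i, h i A (k |: B) = 0%N) ->
  forall i, h i (k |: A) B = 0%N.
Proof.
move=> hB hkB; have [r [_ e0 eS]] := les A B k.
by case=> [|i]; rewrite ?e0 ?eS !(hB, hkB).
Qed.

(** The Koszul complex on [#|A|] variables has length [#|A|]. *)
Lemma koszul_bound i A B : (#|A| < i)%N -> h i A B = 0%N.
Proof.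
elim/set_ind: A i B => [|k A kA IH] [|i] B //; rewrite ?cardsU1 ?kA ?ltnS => ltA.
have [r [_ _ ->]] := les A B k.
by rewrite !IH // ltnW.
Qed.

Lemma koszul1 i k B : h i.+1 [set k] B = 0%N.
Proof.
have [r [rle e0 eS]] := les set0 B k.
rewrite setU0 in e0 eS; case: i => [|i]; rewrite eS !hS // h00.
move: e0; rewrite h01 h00; have [+ _] := rle 0%N; rewrite h00.
have := dimvS (le1 k B); lia.
Qed.

(** If [x_j] acts bijectively, the homology is zero. *)
Lemma koszul_acyclic i j A B : j \in A -> U (j |: B) = U B -> h i A B = 0%N.
Proof.
move=> jA; rewrite -(setD1K jA); move: (A :\ j) => {jA}A.
elim/set_ind: A i B => [|k A kA IH] i B eB.
  rewrite setU0; case: i => [|i]; last exact: koszul1.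
  by rewrite h01 eB subnn.
rewrite setUCA; apply: koszul_vanish_cone => i'; apply: IH => //.
by rewrite setUCA !(hU1 k) eB.
Qed.

(** The restriction to [U (k |: B)] contains the whole space as its [j]-th
    member, so it is acyclic and the long exact sequence identifies the numbers
    with and without [k]. *)
Lemma koszul_dominated i j k A B : j \in A -> (U (k |: B) <= U (j |: B))%VS ->
  h i (k |: A) B = h i A B.
Proof.
move=> jA kj; have [r [rle e0 eS]] := les A B k.
have z i' : h i' A (k |: B) = 0%N.
  by apply: (koszul_acyclic i' jA); rewrite hUU; apply/capv_idPr.
have r0 i' : r i' = 0%N by have [_] := rle i'; rewrite z leqn0 => /eqP.
by case: i => [|i]; rewrite ?e0 ?eS ?z !r0 ?subn0 ?addn0.
Qed.

(** If [U (k |: B)] is transversal to the intersection of the others, the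
    deletion cube modulo the restricted cube is constant, hence acyclic.  In
    terms of the numbers: for [A] a singleton, transversality is an equality of
    dimensions in degree 0; the modular law passes it on to the deletion and
    restriction of a member of [A]. *)
Lemma koszul_coloop i k A B : A != set0 -> (U (A :|: B) + U (k |: B) = U B)%VS ->
  h i (k |: A) B = 0%N.
Proof.
elim/set_ind: A i B => [|j A jA IH] i B; first by rewrite eqxx.
move=> _ eB; rewrite setUCA; have [A0|An0] := eqVneq A set0.
  rewrite A0 !setU0 in eB *; have [r [rle e0 eS]] := les [set k] B j.
  have := dimv_sum_cap (U (j |: B)) (U (k |: B)).
  have -> : (U (j |: B) :&: U (k |: B) = U (k |: (j |: B)))%VS.
    by rewrite hUU capvC.
  rewrite eB => d.
  have e : h 0 (j |: [set k]) B = 0%N.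
    have [jk|jk] := eqVneq j k.
      by move: eB; rewrite jk addvv setUid h01 => ->; rewrite subnn.
    by rewrite h0 big_setU1 ?inE // big_set1 /= eB subnn.
  case: i => [|[|i]]; rewrite ?e // eS !koszul1 // h01.
  move: e; rewrite e0 h01; have := dimvS (le1 k B); have := dimvS (le1 k (j |: B)).
  lia.
have leA : (U (j |: A :|: B) <= U (A :|: B))%VS by rewrite -setUA le1.
have leB A' : (U (A' :|: B) <= U B)%VS by exact/mono/subsetUr.
apply: koszul_vanish_cone => i'; apply: IH => //.
  by apply/eqP; rewrite eqEsubv subv_add leB le1 /= -{1}eB addvS.
apply/eqP; rewrite eqEsubv subv_add le1 mono ?subsetUr //=.
have -> : (U (A :|: (j |: B)) = U (j |: A :|: B))%VS by rewrite setUCA setUA.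
rewrite hUU.
have sub : (U (j |: A :|: B) <= U (j |: B))%VS.
  by apply: mono; rewrite setSU // subsetUl.
apply/subvP => v vj; have := subvP (le1 j B) v vj; rewrite -{1}eB.
move=> /memv_addP [x xA [y yk ev]]; rewrite ev memv_add // memv_cap yk /=.
have -> : y = v - x by rewrite ev addrC addKr.
by rewrite memvB // (subvP sub).
Qed.

Definition hyper k B := (\dim (U (k |: B))).+1 = \dim (U B).

(** Deletion-restriction for hyperplanes.  If the restriction to [U (k |: B)]
    repeats this hyperplane, [k] is redundant; if the deletion has smaller
    rank, [k] is a coloop; otherwise the deletion has the same rank and the
    restriction has rank one less, as the shift in the long exact sequence
    requires. *)
Lemma koszul_hyper i A B : A != set0 -> (forall k, k \in A -> hyper k B) ->
  (\dim (U B) - \dim (U (A :|: B)))%N <> i.+1 -> h i A B = 0%N.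
Proof.
elim/set_ind: A i B => [|k A kA IH] i B; first by rewrite eqxx.
move=> _ hyp; have hk : hyper k B by apply: hyp; rewrite setU11.
have hA j : j \in A -> hyper j B by move=> jA; apply: hyp; rewrite setU1r.
have [->|An0] := eqVneq A set0.
  rewrite setU0; case: i => [|i] ne; last exact: koszul1.
  by move: ne; rewrite -hk subSnn.
have eA : (U (k |: A :|: B) = U (k |: B) :&: U (A :|: B))%VS.
  by rewrite -hU setUUl.
have [/existsP [j /andP [jA /eqP ej]]|] :=
    boolP [exists j, (j \in A) && (U (j |: (k |: B)) == U (k |: B))].
  have kj : (U (k |: B) <= U (j |: B))%VS.
    by rewrite -ej setUCA le1.
  rewrite (koszul_dominated _ jA kj) eA => ne; apply: IH => //.
  have ekj : U (k |: B) = U (j |: B).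
    by apply/eqP; rewrite eqEdim kj /= -ltnS hk (hA j jA).
  by move: ne; rewrite (capv_idPr _) // ekj mono // setSU // sub1set.
rewrite negb_exists => /forallP nd ne.
have hkA j : j \in A -> hyper j (k |: B).
  move=> jA; have := nd j; rewrite jA /= hUU => nej.
  have lt : (\dim (U (j |: B) :&: U (k |: B)) < \dim (U (k |: B)))%N.
    by rewrite ltn_neqAle dimvS ?capvSr // andbT (dimv_leqif_eq (capvSr _ _)).
  have := dimv_sum_cap (U (j |: B)) (U (k |: B)).
  have := hA j jA; rewrite /hyper hUU; move: hk; rewrite /hyper.
  have : (\dim (U (j |: B) + U (k |: B)) <= \dim (U B))%N.
    by apply: dimvS; rewrite subv_add !le1.
  lia.
have [sub|nsub] := boolP (U (A :|: B) <= U (k |: B))%VS; last first.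
  apply: koszul_coloop => //; apply/eqP; rewrite eqEdim subv_add le1 mono ?subsetUr //=.
  have := dimv_sum_cap (U (A :|: B)) (U (k |: B)).
  have : (\dim (U (A :|: B) :&: U (k |: B)) < \dim (U (A :|: B)))%N.
    rewrite ltn_neqAle dimvS ?capvSl // andbT (dimv_leqif_eq (capvSl _ _)).
    by apply: contra nsub => /eqP/capv_idPl.
  move: hk; rewrite /hyper; lia.
rewrite eA (capv_idPr sub) in ne.
have ekB : (U (A :|: (k |: B)) = U (A :|: B))%VS.
  by rewrite setUCA setUA eA (capv_idPr sub).
have [r [_ e0 eS]] := les A B k.
case: i ne => [|i] ne; rewrite ?e0 ?eS.
  by rewrite (IH 0%N B).
rewrite (IH i.+1 B) // (IH i (k |: B)) // ekB.
have := dimvS sub; move: ne; move: hk; rewrite /hyper; lia.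
Qed.

(** Members contained in a hyperplane [U (j |: B)], [j] in [A0], are dominated,
    so only the hyperplanes matter, also for the rank. *)
Lemma koszul_concentration i (A0 A : {set T}) B : A0 \subset A -> A0 != set0 ->
  (forall k, k \in A0 -> hyper k B) ->
  (forall k, k \in A -> exists2 j, j \in A0 & (U (k |: B) <= U (j |: B))%VS) ->
  (\dim (U B) - \dim (U (A0 :|: B)))%N <> i.+1 -> h i A B = 0%N.
Proof.
move=> /setUidPr <- An0 hyp dom ne.
suff -> : h i (A0 :|: A) B = h i A0 B by exact: koszul_hyper.
elim/set_ind: A dom => [|k A kA IH] dom; first by rewrite setU0.
have [|j jA0 kj] := dom k; first by rewrite !inE eqxx orbT.
rewrite setUCA (koszul_dominated _ _ kj) ?inE ?jA0 // IH // => k' k'A.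
by apply: dom; rewrite setUCA setU1r.
Qed.

(** Euler characteristics are additive in the long exact sequence: the ranks
    [r] cancel, up to the last one, which vanishes by [koszul_bound]. *)
Lemma koszul_euler N A B : (#|A| < N)%N ->
  \sum_(i < N) (-1) ^+ i * (h i A B)%:Z =
  \sum_(C : {set T} | C \subset A) (-1) ^+ #|C| * (\dim (U (C :|: B)))%:Z.
Proof.
elim/set_ind: A N B => [|k A kA IH] [|N] B //.
  move=> _; rewrite big_ord_recl big1 => [|i _]; last by rewrite hS mulr0.
  rewrite (big_pred1 set0) => [|C]; last by rewrite subset0.
  by rewrite set0U cards0 h00 addr0.
rewrite cardsU1 kA ltnS => ltA; rewrite big_subset_setU1 // -(IH N.+1) ?ltnS 1?ltnW //.
have -> : \sum_(C : {set T} | C \subset A)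
    (-1) ^+ #|k |: C| * (\dim (U (k |: C :|: B)))%:Z =
  - \sum_(i < N) (-1) ^+ i * (h i A (k |: B))%:Z.
  rewrite (IH N) // -sumrN; apply: eq_bigr => C CA.
  have kC : k \notin C by apply: contra kA; apply: (subsetP CA).
  by rewrite cardsU1 kC exprS mulN1r mulNr [k |: C]setUC -setUA.
have [r [rle e0 eS]] := les A B k.
have rN : r N = 0%N by have [_] := rle N; rewrite koszul_bound // leqn0 => /eqP.
pose x i := (h i A B - r i)%N.
have -> : \sum_(i < N.+1) (-1) ^+ i * (h i (k |: A) B)%:Z =
    \sum_(i < N.+1) (-1) ^+ i * (x i)%:Z -
    \sum_(i < N) (-1) ^+ i * ((h i A (k |: B))%:Z - (r i)%:Z).
  rewrite !big_ord_recl e0 -addrA -sumrN -big_split /=; congr (_ + _).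
  apply: eq_bigr => i _; rewrite eS PoszD -(subzn (proj2 (rle i))).
  by rewrite /bump add1n exprS; ring.
have -> : \sum_(i < N.+1) (-1) ^+ i * (h i A B)%:Z =
    \sum_(i < N.+1) (-1) ^+ i * (x i)%:Z + \sum_(i < N) (-1) ^+ i * (r i)%:Z.
  transitivity (\sum_(i < N.+1) (-1) ^+ i * ((x i)%:Z + (r i)%:Z)).
    by apply: eq_bigr => i _; rewrite -PoszD subnK //; case: (rle i).
  under eq_bigr do rewrite mulrDr.
  by rewrite big_split /= [X in _ + X]big_ord_recr /= rN mulr0 addr0.
rewrite -addrA; congr (_ + _); rewrite -[in RHS]sumrB -sumrN.
by apply: eq_bigr => i _; ring.
Qed.
End KoszulNumbers.

(** * Moebius function and crosscuts *)

Section Crosscut.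
Variables (K : fieldType) (V : vectType K) (t : nat) (H : 'I_t -> {vspace V}).
Local Notation flats := (flats H).
Local Notation mobius := (mobius H).

Lemma uniq_flats : uniq flats. Proof. exact: undup_uniq. Qed.

Lemma sum_mobius (Y W : {vspace V}) : W \in flats ->
  \sum_(Z <- flats | (Y <= Z)%VS && (Z <= W)%VS) mobius Y Z = (Y == W)%:R.
Proof.
move=> Wf; have [YW|nYW] := boolP (Y <= W)%VS; last first.
  rewrite big1 => [|Z /andP [YZ ZW]]; last by rewrite (subv_trans YZ ZW) in nYW.
  by case: eqP nYW => // ->; rewrite subvv.
rewrite big_mkcond (bigD1_seq W) ?uniq_flats //= YW subvv -big_mkcondr /=.
have [<-|nYW] := eqVneq Y W.
  rewrite mobius_refl big1 ?addr0 // => Z /and3P [+ YZ ZY].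
  by rewrite eqEsubv ZY YZ.
rewrite [X in X + _]mobius_lt // addrC.
by under eq_bigl do rewrite andbC -andbA; rewrite subrr.
Qed.

(** Let [f Y] be the sum of [(-1) ^ #|A|] over the [A] with [U A = Y].  Its sums
    over upper intervals [Z <= Y] are the sums over the [A] with [Z <= U A];
    for a flat [Z < X] these cancel in pairs [A], [k |: A], where [U [set k]]
    contains [Z], so only [Z = X] contributes.  Moebius inversion gives
    [f Y = mu(Y, X)]. *)
Lemma crosscut (T : finType) (U : {set T} -> {vspace V}) :
  (forall A B, U (A :|: B) = U A :&: U B)%VS ->
  (forall A, U A \in flats) ->
  (forall k, U [set k] != U set0) ->
  (forall Y, Y \in flats -> (Y <= U set0)%VS -> Y != U set0 ->
     exists k, (Y <= U [set k])%VS) ->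
  \sum_(A : {set T}) (-1) ^+ #|A| * (\dim (U A))%:Z =
  \sum_(Y <- flats | (Y <= U set0)%VS) (\dim Y)%:Z * mobius Y (U set0).
Proof.
move=> hU Uf neU cov; set X := U set0.
have UX A : (U A <= X)%VS by rewrite -(set0U A) hU capvSl.
have upper Z : Z \in flats ->
    \sum_(A : {set T} | (Z <= U A)%VS) (-1) ^+ #|A| = (Z == X)%:R :> int.
  move=> Zf; have [->|nZX] := eqVneq Z X.
    rewrite (big_pred1 set0) ?cards0 // => A; apply/idP/eqP => [XA|->]; last exact: subvv.
    have [//|[k kA]] := set_0Vmem A; case/negP: (neU k).
    rewrite eqEsubv UX; apply: subv_trans XA _.
    by rewrite -(setD1K kA) hU capvSl.
  have [ZX|nZ] := boolP (Z <= X)%VS; last first.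
    by rewrite big1 // => A ZA; rewrite (subv_trans ZA (UX A)) in nZ.
  have [k Zk] := cov Z Zf ZX nZX.
  have -> : \sum_(A : {set T} | (Z <= U A)%VS) (-1) ^+ #|A| =
      \sum_(A : {set T} | A \subset k |: [set~ k])
         (if (Z <= U A)%VS then (-1) ^+ #|A| else 0 : int).
    rewrite -big_mkcondr; apply: eq_bigl => A.
    by rewrite (_ : k |: _ = setT) ?subsetT //; apply/setP => x; rewrite !inE orbN.
  rewrite big_subset_setU1 ?setC11 // -big_split big1 // => A Ak.
  have kA : k \notin A by apply/negP => /(subsetP Ak); rewrite setC11.
  rewrite hU subv_cap Zk cardsU1 kA exprS mulN1r /=.
  by case: ifP => _; rewrite ?addr0 ?subrr.
have fE Y : Y \in flats ->
    \sum_(A : {set T} | U A == Y) (-1) ^+ #|A| = mobius Y X.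
  move=> Yf.
  transitivity (\sum_(A : {set T}) (-1) ^+ #|A| * (Y == U A)%:R : int).
    rewrite big_mkcond; apply: eq_bigr => A _.
    by rewrite eq_sym; case: eqP; rewrite ?mulr1 ?mulr0.
  under eq_bigr => A _ do rewrite -(sum_mobius _ (Uf A)) mulr_sumr big_mkcond.
  rewrite exchange_big /=.
  transitivity (\sum_(Z <- flats) if (Y <= Z)%VS then mobius Y Z * (Z == X)%:R else 0).
    rewrite big_seq [RHS]big_seq; apply: eq_bigr => Z Zf.
    case: ifP => YZ; last by rewrite big1.
    rewrite -upper // mulr_sumr [RHS]big_mkcond; apply: eq_bigr => A _.
    by rewrite mulrC.
  rewrite (bigD1_seq X (Uf set0) uniq_flats) /= big1 ?addr0 => [|Z nZ]; last first.
    by rewrite (negPf nZ) mulr0 if_same.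
  rewrite eqxx mulr1; case: ifP => // /negbT nYX.
  by rewrite mobius_nle.
transitivity (\sum_(Y <- flats) (\dim Y)%:Z * mobius Y X); last first.
  rewrite [RHS]big_mkcond; apply: eq_bigr => Y _.
  by case: ifP => // /negbT nYX; rewrite mobius_nle // mulr0.
transitivity (\sum_(Y <- flats) \sum_(A : {set T})
    if U A == Y then (\dim Y)%:Z * (-1) ^+ #|A| else 0); last first.
  rewrite big_seq [RHS]big_seq; apply: eq_bigr => Y Yf.
  by rewrite -fE // mulr_sumr [RHS]big_mkcond.
rewrite exchange_big /=; apply: eq_bigr => A _.
rewrite (bigD1_seq (U A) (Uf A) uniq_flats) /= eqxx big1 ?addr0 1?mulrC // => Y.
by rewrite eq_sym => /negPf ->.
Qed.

End Crosscut.

(** * Coordinate subspaces *)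

Section CoordinateSubspaces.
Variables (K : fieldType) (r : nat).
Implicit Types (P Q : pred 'I_r) (v : 'rV[K]_r).

Definition coordspace P : {vspace 'rV[K]_r} :=
  lker (linfun (mulmxr (diag_mx (\row_j (~~ P j)%:R)))).

Lemma coordspaceP P v :
  reflect (forall j, v 0 j != 0 -> P j) (v \in coordspace P).
Proof.
rewrite memv_ker lfunE /=; apply: (iffP eqP) => [/rowP v0 j vj|vP].
  have := v0 j; rewrite mul_mx_diag !mxE; case: (P j) => //= /eqP.
  by rewrite mulr1 (negPf vj).
apply/rowP => j; rewrite mul_mx_diag !mxE.
have [->|/vP ->] := eqVneq (v 0 j) 0; first by rewrite mul0r.
by rewrite mulr0.
Qed.

Lemma eq_coordspace P Q : P =1 Q -> coordspace P = coordspace Q.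
Proof.
by move=> PQ; apply/vspaceP => v; apply/coordspaceP/coordspaceP => vP j /vP;
   rewrite PQ.
Qed.

Lemma coordspaceS P Q : subpred P Q -> (coordspace P <= coordspace Q)%VS.
Proof. by move=> PQ; apply/subvP => v /coordspaceP vP; apply/coordspaceP => j /vP/PQ. Qed.

Lemma coordspaceI P Q : (coordspace P :&: coordspace Q)%VS = coordspace (predI P Q).
Proof.
apply/vspaceP => v; rewrite memv_cap; apply/andP/coordspaceP => [[]|vPQ].
  by move=> /coordspaceP vP /coordspaceP vQ j vj; rewrite /= vP // vQ.
by split; apply/coordspaceP => j /vPQ /andP [].
Qed.

Lemma coordspaceU P Q : (coordspace P + coordspace Q)%VS = coordspace (predU P Q).
Proof.
apply/eqP; rewrite eqEsubv subv_add !coordspaceS //= => [|j|j] /=; last first.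
- by move->.
- by move->; rewrite orbT.
apply/subvP => v /coordspaceP vPQ.
have -> : v = (\row_j if P j then v 0 j else 0) + (\row_j if P j then 0 else v 0 j).
  by apply/rowP => j; rewrite !mxE; case: ifP; rewrite ?addr0 ?add0r.
apply: memv_add; apply/coordspaceP => j; rewrite mxE; case: ifP => //; rewrite ?eqxx //.
by move=> Pj /vPQ /=; rewrite Pj.
Qed.

Lemma coordspace0 : coordspace pred0 = 0%VS.
Proof.
apply/vspaceP => v; rewrite memv0; apply/coordspaceP/eqP => [v0|->] => [|j].
  by apply/rowP => j; rewrite mxE; apply/eqP/negPn/negP => /v0.
by rewrite mxE eqxx.
Qed.

Lemma coordspaceT : coordspace predT = fullv.
Proof. by apply/vspaceP => v; rewrite memvf; apply/coordspaceP. Qed.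

Lemma coordspace_bigU (I : finType) (A : {set I}) (P : I -> pred 'I_r) :
  (\sum_(k in A) coordspace (P k))%VS =
  coordspace (fun j => [exists k in A, P k j]).
Proof.
elim/set_ind: A => [|k A kA IH].
  rewrite big_set0 -coordspace0; apply: eq_coordspace => j /=.
  by apply/esym/existsP => -[k]; rewrite inE.
rewrite big_setU1 //= IH coordspaceU; apply: eq_coordspace => j /=.
apply/orP/existsP => [[Pj|/existsP [k' /andP [k'A Pj]]]|[k']].
- by exists k; rewrite setU11.
- by exists k'; rewrite setU1r.
rewrite !inE => /andP [/orP [/eqP ->|k'A] Pj]; first by left.
by right; apply/existsP; exists k'; rewrite k'A.
Qed.

(** The spanning vectors give an upper bound; it is sharp since the bounds for
    [P] and its complement add up to the dimension of the whole space. *)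
Lemma dim_coordspace P : \dim (coordspace P) = #|P|.
Proof.
have le Q : (\dim (coordspace Q) <= #|Q|)%N.
  pose X := [seq (delta_mx 0 j : 'rV[K]_r) | j <- enum Q].
  have <- : size X = #|Q| by rewrite size_map -cardE.
  apply: leq_trans (dim_span X); apply: dimvS; apply/subvP => v /coordspaceP vQ.
  rewrite (row_sum_delta v); apply: memv_suml => j _.
  have [->|/vQ Qj] := eqVneq (v 0 j) 0; first by rewrite scale0r mem0v.
  by apply/memvZ/memv_span/map_f; rewrite mem_enum.
have := dimv_sum_cap (coordspace P) (coordspace (predC P)).
have -> : (coordspace P :&: coordspace (predC P))%VS = 0%VS.
  by rewrite coordspaceI -coordspace0; apply: eq_coordspace => j /=; rewrite andbN.
have -> : (coordspace P + coordspace (predC P))%VS = fullv.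
  by rewrite coordspaceU -coordspaceT; apply: eq_coordspace => j /=; rewrite orbN.
rewrite dimv0 addn0 dimvf /dim /= mul1n.
have e : (#|P| + #|predC P|)%N = r by rewrite -[RHS](card_ord r) -(cardC P).
move: (le P) (le (predC P)) e.
move: #|P| #|predC P| (\dim (coordspace P)) (\dim (coordspace (predC P))) => a b c d.
lia.
Qed.

End CoordinateSubspaces.

(** * Graded modules and cocones *)

Section Degrees.
Variables (K : fieldType) (n : nat).
Local Notation S := {mpoly K[n]}.
Implicit Types (a b c d : Zn n) (p : S).

Definition zle a b := [forall k, a k <= b k].

Lemma zleP a b : reflect (forall k, a k <= b k) (zle a b).
Proof. exact: forallP. Qed.

Lemma zle_refl a : zle a a. Proof. exact/zleP. Qed.

Lemma zle_trans b a c : zle a b -> zle b c -> zle a c.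
Proof. by move=> /zleP ab /zleP bc; apply/zleP => k; apply: le_trans (ab k) (bc k). Qed.

Definition zmax a b : Zn n := [ffun k => Num.max (a k) (b k)].

Lemma zmaxl a b : zle a (zmax a b).
Proof. by apply/zleP => k; rewrite ffunE le_max lexx. Qed.

Lemma zmaxr a b : zle b (zmax a b).
Proof. by apply/zleP => k; rewrite ffunE le_max lexx orbT. Qed.

Lemma zle_bound (s : seq (Zn n)) : exists b, forall c, c \in s -> zle c b.
Proof.
elim: s => [|a s [b bP]]; first by exists 0.
exists (zmax a b) => c; rewrite inE => /orP [/eqP ->|/bP cb]; first exact: zmaxl.
exact: zle_trans cb (zmaxr _ _).
Qed.

Definition mdiff a b : 'X_{1..n} := [multinom `|b k - a k|%N | k < n].

Lemma mdiffK a b : zle a b -> mnm_deg (mdiff a b) + a = b.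
Proof.
move=> /zleP ab; apply/ffunP => k; rewrite !ffunE mnmE.
by rewrite gez0_abs ?subrK // subr_ge0.
Qed.

Lemma S_homogX (m : 'X_{1..n}) : S_homog (mnm_deg m) ('X_[m] : S).
Proof. by move=> m'; rewrite msuppX inE => /eqP ->. Qed.

Lemma S_homogC (x : K) : S_homog 0 (x%:MP : S).
Proof.
move=> m; rewrite msuppC; case: ifP => // _; rewrite inE => /eqP ->.
by apply/ffunP => k; rewrite !ffunE mnm0E.
Qed.

Lemma mnm_deg_inj : injective (@mnm_deg n).
Proof.
move=> m1 m2 /ffunP e; apply/mnmP => k; have := e k; rewrite !ffunE.
by case.
Qed.

(** The components of [S] are at most one-dimensional; hence a homogeneous
    polynomial is determined by its degree and its value at [(1, ..., 1)]. *)
Lemma S_homog_mono d p : S_homog d p -> p != 0 ->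
  exists m, mnm_deg m = d /\ p = p@_m *: 'X_[m].
Proof.
move=> hp; rewrite -msupp_eq0; case E: (msupp p) => [//|m s] _.
have hm : mnm_deg m = d by apply: hp; rewrite E mem_head.
exists m; split=> //; apply/mpolyP => m'; rewrite mcoeffZ mcoeffX.
have [<-|nm] := eqVneq m m'; first by rewrite mulr1.
rewrite mulr0; apply: memN_msupp_eq0; apply: contra nm => /hp.
by rewrite -hm => /mnm_deg_inj ->.
Qed.

Definition ev1 p : K := p.@[fun=> 1].

Lemma ev1X (m : 'X_{1..n}) : ev1 'X_[m] = 1.
Proof. by rewrite /ev1 mevalX big1 // => k _; rewrite expr1n. Qed.

Lemma S_homog_ev1 d p : S_homog d p -> ev1 p = 0 -> p = 0.
Proof.
move=> hp; have [//|/(S_homog_mono hp) [m [_ e]]] := eqVneq p 0 => p0.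
have := congr1 ev1 e; rewrite [RHS]mevalZ [meval _ _]ev1X mulr1 p0 => pm0.
by rewrite e -pm0 scale0r.
Qed.

Lemma S_homog_ge0 d p : S_homog d p -> ev1 p != 0 -> zle 0 d.
Proof.
move=> hp p0; have : p != 0 by apply: contraNneq p0 => ->; rewrite /ev1 meval0.
move=> /(S_homog_mono hp) [m [<- _]].
by apply/zleP => k; rewrite !ffunE.
Qed.

End Degrees.

Section GradedModuleLemmas.
Variables (K : fieldType) (n : nat).
Local Notation S := {mpoly K[n]}.
Implicit Types (M N : gmod K n) (a b c d : Zn n).

Lemma gr_sum M c (I : Type) (s : seq I) (P : pred I) (f : I -> M) :
  (forall i, P i -> gr c (f i)) -> gr c (\sum_(i <- s | P i) f i).
Proof.
move=> fP; elim/big_ind: _ => //; [exact: gr0|exact: grD].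
Qed.

Lemma grC M c (x : K) (u : M) : gr c u -> gr c (x%:MP *: u).
Proof. by move=> uc; rewrite -[c]add0r; apply: grZ => //; apply: S_homogC. Qed.

Lemma grN M c (u : M) : gr c u -> gr c (- u).
Proof. by move=> uc; rewrite -scaleN1r -mpolyC1 -mpolyCN; apply: grC. Qed.

Lemma grX M c m (u : M) : zle c m -> gr c u -> gr m ('X_[mdiff c m] *: u).
Proof.
move=> cm uc; rewrite -{1}(mdiffK cm); apply: grZ => //; exact: S_homogX.
Qed.

(** Comparing components, the component of [w] of degree [c] has the same image
    as [w]. *)
Lemma gr_component M N d (f : {additive M -> N}) c w :
  (forall c u, gr c u -> gr (d + c) (f u)) -> gr (d + c) (f w) ->
  exists2 w', gr c w' & f w' = f w.
Proof.
move=> hf fw; have [s0 [g0 [us0 gr0' ew0]]] := gr_decomp w.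
(* [c] may be missing from the decomposition of [w]; it is then added with
   component 0. *)
have [s [g [us grg ew cs]]] : exists s (g : Zn n -> M),
    [/\ uniq s, forall c', gr c' (g c'), w = \sum_(c' <- s) g c' & c \in s].
  have [cs|cs] := boolP (c \in s0); first by exists s0, g0.
  exists (c :: s0), (fun c' => if c' == c then 0 else g0 c'); split.
  - by rewrite /= cs.
  - by move=> c'; case: ifP => // _; apply: gr0.
  - rewrite big_cons eqxx add0r ew0; apply: eq_big_seq => c' c's.
    by case: eqP => // e; rewrite -e c's in cs.
  - exact: mem_head.
exists (g c) => //; apply/eqP; rewrite -subr_eq0; apply/eqP.
pose F e : N := f (g (e - d)) - (if e == d + c then f w else 0).
have hF e : gr e (F e).
  apply: grD; first by have := hf _ _ (grg (e - d)); rewrite addrC subrK.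
  by apply: grN; case: eqP => [->|_] //; apply: gr0.
have := @gr_direct _ _ N [seq d + c' | c' <- s] F _ hF _ (d + c) _.
rewrite /F eqxx [d + c]addrC addrK; apply.
- by rewrite map_inj_uniq //; apply: addrI.
- rewrite big_map sumrB; under eq_bigr do rewrite [d + _]addrC addrK.
  rewrite -raddf_sum -ew (bigD1_seq c) //= big1 ?addr0 => [|c' nc].
    by rewrite [d + c]addrC eqxx subrr.
  by rewrite [c + d]addrC (inj_eq (addrI _)) (negPf nc).
- by rewrite addrC; apply: map_f.
Qed.

Lemma gr_component_hom M N (f : {linear M -> N}) c w :
  graded_hom f -> gr c (f w) -> exists2 w', gr c w' & f w' = f w.
Proof.
move=> hf fw; apply: (@gr_component _ _ 0 f); last by rewrite add0r.
by move=> c' u; rewrite add0r; apply: hf.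
Qed.

End GradedModuleLemmas.

Section Cocones.
Variables (K : fieldType) (n : nat) (M : gmod K n) (W : lmodType K) (g : M -> W).
Hypothesis gP : is_cocone g.

Lemma coconeD u v : g (u + v) = g u + g v. Proof. by case: gP. Qed.

Lemma coconeX m u : g ('X_[m] *: u) = g u.
Proof.
have [_ _ gX] := gP; rewrite mpolyXE_id.
elim/big_ind: _ u => [u|p q hp hq u|k _ u]; first by rewrite scale1r.
  by rewrite -scalerA hp hq.
by elim: (m k) => [|e IH]; rewrite ?scale1r // exprS -scalerA gX.
Qed.

Lemma cocone0 : g 0 = 0.
Proof. by have [_ gC _] := gP; rewrite -(scaler0 _ (0%:MP)) gC scale0r. Qed.

Lemma cocone_sum (I : Type) (s : seq I) (P : pred I) (f : I -> M) :
  g (\sum_(i <- s | P i) f i) = \sum_(i <- s | P i) g (f i).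
Proof. exact: (big_morph g coconeD cocone0). Qed.

Lemma coconeN u : g (- u) = - g u.
Proof. by apply/eqP; rewrite -addr_eq0 -coconeD addNr cocone0. Qed.

End Cocones.

(** In the colimit every element comes from a single component, of any
    sufficiently large degree.  Quantifying over all cocones avoids a
    construction of the colimit. *)
Lemma homogenize (K : fieldType) (n : nat) (M : gmod K n) (u : M) :
  exists b, forall m, zle b m -> exists2 u', gr m u' &
    forall (W : lmodType K) (g : M -> W), is_cocone g -> g u' = g u.
Proof.
have [s [f [_ hf ->]]] := gr_decomp u; have [b sb] := zle_bound s.
exists b => m bm; exists (\sum_(c <- s) 'X_[mdiff c m] *: f c).
  rewrite big_seq; apply: gr_sum => c /sb cb; apply: grX => //.
  exact: zle_trans cb bm.
move=> W g gP; rewrite !cocone_sum //; apply: eq_bigr => c _; exact: coconeX.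
Qed.

(** * Graded free modules with variables specialised at 1 *)

(** The colimit [K^r] of a graded free module with [r] generators of degrees
    [cdeg j], in a form that no longer refers to a basis: [cev] substitutes 1
    for the variables in the coordinates and maps the component of degree [c]
    bijectively to the vectors supported on the generators of degree at most
    [c]. *)
Record coordinates (K : fieldType) (n : nat) (M : gmod K n) (b : Zn n -> nat) :=
  Coordinates {
    crk : nat;
    cdeg : 'I_crk -> Zn n;
    cev : M -> 'rV[K]_crk;
    cev_cocone : is_cocone cev;
    cev_supp : forall c u, gr c u -> forall j, cev u 0 j != 0 -> zle (cdeg j) c;
    cev_inj : forall c u, gr c u -> cev u = 0 -> u = 0;
    cev_surj : forall c (v : 'rV[K]_crk), (forall j, v 0 j != 0 -> zle (cdeg j) c) ->
      exists2 u, gr c u & cev u = v;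
    cev_min : forall c u, gr c u -> in_max_ideal_mul u ->
      forall j, cdeg j = c -> cev u 0 j = 0;
    cev_count : forall c, b c = #|[pred j | cdeg j == c]|
  }.

Lemma graded_free_coordinates (K : fieldType) (n : nat) (M : gmod K n) b :
  graded_free M b -> inhabited (coordinates M b).
Proof.
case=> ds [bE [f [[f' fK f'K] fgr]]]; constructor.
pose dg j := tnth (in_tuple ds) j.
pose F u : 'rV[{mpoly K[n]}]_(size ds) := f u.
have FD u v : F (u + v) = F u + F v by rewrite /F raddfD.
have FZ p u : F (p *: u) = p *: F u by rewrite /F linearZ.
have Fgr c u j : gr c u -> S_homog (c - dg j) (F u 0 j).
  by move=> /fgr /(_ j).
pose ev u : 'rV[K]_(size ds) := \row_j ev1 (F u 0 j).
exists (size ds) dg ev.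
- split=> [u v|x u|k u]; apply/rowP => j.
  + by rewrite !mxE FD mxE /ev1 mevalD.
  + by rewrite !mxE FZ mxE /ev1 mevalM mevalC.
  + by rewrite !mxE FZ mxE /ev1 mevalM mevalXU mul1r.
- move=> c u uc j; rewrite mxE => /(S_homog_ge0 (Fgr c u j uc)) /zleP h.
  by apply/zleP => k; have := h k; rewrite !ffunE subr_ge0.
- move=> c u uc /rowP u0; apply: (can_inj fK); rewrite raddf0.
  apply/rowP => j; rewrite [RHS]mxE; apply: (S_homog_ev1 (Fgr c u j uc)).
  by have := u0 j; rewrite !mxE.
- move=> c v vP.
  pose w : 'rV[{mpoly K[n]}]_(size ds) := \row_j (v 0 j *: 'X_[mdiff (dg j) c]).
  have Fw : F (f' w) = w by rewrite /F f'K.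
  exists (f' w).
    apply/fgr; rewrite f'K => j; rewrite mxE -mul_mpolyC.
    have [->|/vP vj] := eqVneq (v 0 j) 0; first by rewrite mpolyC0 mul0r; apply: S_homog0.
    rewrite -[_ - _]add0r; apply: S_homogM; first exact: S_homogC.
    have -> : c - tnth (in_tuple ds) j = mnm_deg (mdiff (dg j) c).
      by rewrite -[in LHS](mdiffK vj) addrK.
    exact: S_homogX.
  by apply/rowP => j; rewrite mxE Fw mxE /ev1 mevalZ [meval _ 'X_[_]]ev1X mulr1.
- move=> c u uc [v uv] j dj; rewrite mxE.
  have h0 : S_homog 0 (F u 0 j) by have := Fgr c u j uc; rewrite dj subrr.
  have [->|/(S_homog_mono h0) [m [m0 e]]] := eqVneq (F u 0 j) 0.
    by rewrite /ev1 meval0.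
  have {m0} m0 : m = 0%MM.
    by apply: mnm_deg_inj; rewrite m0; apply/ffunP => k; rewrite !ffunE mnm0E.
  rewrite m0 mpolyX0 alg_mpolyC in e.
  have : (F u 0 j).@[fun=> 0] = 0.
    rewrite uv /F raddf_sum summxE raddf_sum big1 //= => k _.
    by rewrite linearZ mxE mevalM mevalXU mul0r.
  by rewrite {1}e mevalC => z; rewrite e z mpolyC0 /ev1 meval0.
- move=> c; rewrite bE -sum1_count big_tnth -sum1_card.
  by apply: eq_bigl => j; rewrite /dg inE.
Qed.

Section CoordinateLemmas.
Variables (K : fieldType) (n : nat) (M : gmod K n) (b : Zn n -> nat).
Variable co : coordinates M b.

Definition cle (c : Zn n) : pred 'I_(crk co) := fun j => zle (cdeg j) c.

Definition cspace (c : Zn n) := coordspace K (cle c).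

Lemma cev_in c u : gr c u -> cev co u \in cspace c.
Proof. by move=> uc; apply/coordspaceP; apply: cev_supp. Qed.

Lemma cev_lift c v : v \in cspace c -> exists2 u, gr c u & cev co u = v.
Proof. by move/coordspaceP; apply: cev_surj. Qed.

Lemma cspace_large (v : 'rV[K]_(crk co)) : exists b, forall m, zle b m -> v \in cspace m.
Proof.
have [b0 hb] := zle_bound [seq cdeg j | j <- enum 'I_(crk co)].
exists b0 => m bm; apply/coordspaceP => j _; apply: zle_trans bm.
by apply: hb; apply: map_f; rewrite mem_enum.
Qed.

(** [cev] is a colimit: a vector [u] with [cev u = 0] is identified by every
    cocone with a homogeneous one, which is then zero. *)
Lemma cev_factor (W : vectType K) (g : M -> W) : is_cocone g ->
  exists gam : 'Hom('rV[K]_(crk co), W), forall u, gam (cev co u) = g u.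
Proof.
move=> gP; have evP := cev_cocone co.
have kerg u : cev co u = 0 -> g u = 0.
  have [b0 hb] := homogenize u; have [u' u'b eu] := hb b0 (zle_refl b0).
  rewrite -(eu _ _ evP) -(eu _ _ gP) => /(cev_inj u'b) ->; exact: cocone0.
have /fin_all_exists [e eP] j : exists u, cev co u = delta_mx 0 j.
  have [b0 hb] := cspace_large (delta_mx 0 j).
  by have [u _ <-] := cev_lift (hb _ (zle_refl _)); exists u.
pose f (v : 'rV[K]_(crk co)) := \sum_j v 0 j *: g (e j).
have lf : linear f.
  move=> x v w; rewrite /f scaler_sumr -big_split; apply: eq_bigr => j _.
  by rewrite !mxE scalerDl scalerA.
pose fl : {linear 'rV[K]_(crk co) -> W} :=
  HB.pack f (GRing.isLinear.Build K _ W *:%R f lf).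
exists (linfun fl) => u; rewrite lfunE /= /f.
pose w := \sum_j (cev co u 0 j)%:MP *: e j.
have gw : g w = \sum_j cev co u 0 j *: g (e j).
  by rewrite cocone_sum //; apply: eq_bigr => j _; case: gP => _ ->.
have ew : cev co w = cev co u.
  rewrite cocone_sum // [RHS]row_sum_delta; apply: eq_bigr => j _.
  by case: evP => _ -> _; rewrite eP.
rewrite -gw; apply/eqP; rewrite -subr_eq0 -(coconeN gP) -(coconeD gP) kerg //.
by rewrite coconeD // coconeN // ew subrr.
Qed.

End CoordinateLemmas.

(** * The specialised resolution *)

Section ScalarResolution.
Variables (K : fieldType) (n : nat) (E : gmod K n) (F : nat -> gmod K n).
Variables (d : forall i, {linear F i.+1 -> F i}) (eps : {linear F 0%N -> E}).
Variables (b : nat -> Zn n -> nat) (co : forall i, coordinates (F i) (b i)).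
Hypothesis res : minimal_graded_resolution d eps.
Variable del : forall i, 'Hom('rV[K]_(crk (co i.+1)), 'rV[K]_(crk (co i))).
Hypothesis delP : forall i u, del i (cev (co i.+1) u) = cev (co i) (d i u).
Implicit Types (c : Zn n).

Lemma cev_onto i v : exists u, cev (co i) u = v.
Proof.
have [b0 hb] := cspace_large v.
by have [u _ <-] := cev_lift (hb _ (zle_refl _)); exists u.
Qed.

Lemma del_del i v : del i (del i.+1 v) = 0.
Proof.
have [u <-] := cev_onto v; rewrite !delP.
have [_ _ _ ex _] := res.
have /ex -> : exists w, d i.+1 w = d i.+1 u by exists u.
exact/cocone0/cev_cocone.
Qed.

Lemma del_cspace i c : (del i @: cspace (co i.+1) c <= cspace (co i) c)%VS.
Proof.
have [[_ dgr] _ _ _ _] := res.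
apply/subvP => w /memv_imgP [v /cev_lift [u uc <-] ->].
by rewrite delP; apply/cev_in/dgr.
Qed.

(** Exactness passes to the coordinate subspaces of each degree, because
    preimages of homogeneous elements can be chosen homogeneous. *)
Lemma cev_exact (N M : gmod K n) bM bN (cM : coordinates M bM) (cN : coordinates N bN)
    (f : {linear N -> M}) (g : 'Hom('rV[K]_(crk cN), 'rV[K]_(crk cM))) c u :
  graded_hom f -> (forall w, g (cev cN w) = cev cM (f w)) ->
  gr c u -> (exists w, f w = u) -> cev cM u \in (g @: cspace cN c)%VS.
Proof.
move=> fgr gP uc [w fw].
have [|w' w'c fw'] := @gr_component_hom _ _ _ _ f c w fgr; first by rewrite fw.
by rewrite -fw -fw' -gP memv_img // cev_in.
Qed.

Lemma del_exact i c :
  (cspace (co i.+1) c :&: lker (del i) <= del i.+1 @: cspace (co i.+2) c)%VS.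
Proof.
have [[_ dgr] _ _ ex _] := res.
apply/subvP => v; rewrite memv_cap => /andP [/cev_lift [u uc <-]]; rewrite memv_ker.
rewrite delP => /eqP /(cev_inj (dgr _ _ _ uc)) /ex exu.
exact: (cev_exact (dgr i.+1) (delP (i := i.+1)) uc exu).
Qed.

(** Minimality: in degree [c] the coefficient at a generator of degree [c] is a
    constant lying in the maximal ideal. *)
Lemma del_minimal i c v j : v \in cspace (co i.+1) c -> cdeg j = c ->
  del i v 0 j = 0.
Proof.
have [[_ dgr] _ _ _ mi] := res.
move=> /cev_lift [u uc <-] jc; rewrite delP.
by apply: (cev_min (dgr _ _ _ uc)).
Qed.

Hypothesis E_tf : forall m (u : E), 'X_[m] *: u = 0 -> u = 0.
Variables (bE : vectType K) (iota : E -> bE).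
Hypothesis colim : is_colimit iota.
Variable e0 : 'Hom('rV[K]_(crk (co 0)), bE).
Hypothesis e0P : forall u, e0 (cev (co 0) u) = iota (eps u).

Let iotaP : is_cocone iota. Proof. by case: colim. Qed.

(** The cokernel of the specialised [d 0] is the vertex of a cocone on [E], so
    [iota u = 0] implies that [u] lifts to some [u'] with [cev u'] in the image
    of [del 0]; in a large degree, a monomial multiple of [u'] is then in the
    image of [d 0], and [u] vanishes by torsion-freeness. *)
Lemma iota_inj c u : gr c u -> iota u = 0 -> u = 0.
Proof.
move=> uc iu; have [[egr dgr] sur ex0 _ _] := res.
have [s sP] := functional_choice _ sur.
(* The kernel of [p] is the image of [del 0], so [p] serves as the projection
   to its cokernel. *)
pose L := limg (del 0); pose p : 'End(_) := (\1 - projv L)%VF.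
have pE v : p v = v - projv L v by rewrite !lfunE /= lfunE /= !lfunE.
have pL v : v \in L -> p v = 0 by move=> vL; rewrite pE projv_id ?subrr.
have ev0P := cev_cocone (co 0).
have pev a a' : eps a = eps a' -> p (cev (co 0) a) = p (cev (co 0) a').
  move=> aa'; apply/eqP; rewrite -subr_eq0 -raddfB /= -(coconeN ev0P) -(coconeD ev0P).
  have /ex0 [w <-] : eps (a - a') = 0 by rewrite linearB /= aa' subrr.
  by rewrite -delP pL ?memv_img ?memvf.
pose g w := p (cev (co 0) (s w)).
have gP : is_cocone g.
  split=> [v w|x v|k v]; rewrite /g.
  - rewrite -raddfD -(coconeD ev0P); apply: pev.
    by rewrite sP raddfD /= !sP.
  - rewrite -linearZ /=; case: (ev0P) => _ <- _; apply: pev.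
    by rewrite sP linearZ /= sP.
  - case: (ev0P) => _ _ evX; rewrite -[in RHS](evX k); apply: pev.
    by rewrite sP linearZ /= sP.
have [_ univ] := colim; have [[h hP] _] := univ _ g gP.
have [|u' u'c eu'] := @gr_component_hom _ _ _ _ eps c (s u) egr.
  by rewrite sP.
have : g u = 0 by rewrite -hP iu raddf0.
rewrite /g -(pev _ _ eu') pE => /eqP; rewrite subr_eq0 => /eqP eL.
have /memv_imgP [z _ ez] : cev (co 0) u' \in L by rewrite eL memv_proj.
have [b1 hb1] := cspace_large z; pose m := zmax c b1.
have [w wm wz] := cev_lift (hb1 m (zmaxr _ _)).
have cm : zle c m := zmaxl _ _.
have e1 : d 0 w = 'X_[mdiff c m] *: u'.
  apply/eqP; rewrite -subr_eq0; apply/eqP; apply: (@cev_inj _ _ _ _ (co 0) m).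
    by apply: grD; [exact: dgr | apply/grN/grX].
  by rewrite coconeD // coconeN // -delP wz -ez coconeX // subrr.
apply: (E_tf (m := mdiff c m)).
have /ex0 : exists w, d 0%N w = 'X_[mdiff c m] *: u' by exists w.
by rewrite linearZ /= eu' sP.
Qed.

Lemma e0_image c v : v \in (e0 @: cspace (co 0) c)%VS <-> exists2 u, gr c u & iota u = v.
Proof.
have [[egr dgr] sur ex0 _ _] := res; split.
  case/memv_imgP => z /cev_lift [u uc <-] ->; exists (eps u); first exact: egr.
  by rewrite e0P.
case=> u uc <-; have [s es] := sur u.
have [|u' u'c eu'] := @gr_component_hom _ _ _ _ eps c s egr; first by rewrite es.
by rewrite -es -eu' -e0P memv_img // cev_in.
Qed.

Lemma e0_ker c : (cspace (co 0) c :&: lker e0 = del 0 @: cspace (co 1) c)%VS.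
Proof.
have [[egr dgr] sur ex0 _ _] := res; apply/eqP; rewrite eqEsubv; apply/andP; split.
  apply/subvP => v; rewrite memv_cap => /andP [/cev_lift [u uc <-]]; rewrite memv_ker.
  rewrite e0P => /eqP /(iota_inj (egr _ _ uc)) /ex0 exu.
  exact: (cev_exact (dgr 0) (delP (i := 0)) uc exu).
rewrite subv_cap del_cspace; apply/subvP => w /memv_imgP [v _ ->].
have [u <-] := cev_onto v; rewrite delP memv_ker e0P.
have /ex0 -> : exists w, d 0%N w = d 0%N u by exists u.
by rewrite cocone0.
Qed.

(** By uniqueness in the universal property: projecting away the image of [e0]
    kills the image of [iota], as the zero map does. *)
Lemma e0_full : limg e0 = fullv.
Proof.
have [_ univ] := colim; have [_ sur _ _ _] := res.
pose p : 'End(bE) := (\1 - projv (limg e0))%VF.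
have c0 : is_cocone (fun _ : E => 0 : bE).
  by split=> *; rewrite ?addr0 ?scaler0.
have [_ uniqh] := univ _ _ c0.
apply/eqP; rewrite eqEsubv subvf; apply/subvP => v _.
have pE w : p w = w - projv (limg e0) w by rewrite !lfunE /= lfunE /= !lfunE.
have : p v = (0 : 'End(bE)) v.
  apply: uniqh => u; last exact: zero_lfunE.
  have [s <-] := sur u.
  suff : p (iota (eps s)) = 0 by [].
  by rewrite -e0P pE projv_id ?subrr // memv_img ?memvf.
rewrite zero_lfunE pE => /eqP; rewrite subr_eq0 => /eqP ->; exact: memv_proj.
Qed.

End ScalarResolution.

(** * Reflexivity and the Klyachko filtrations *)

Section Reflexive.
Variables (K : fieldType) (n : nat) (E : gmod K n).
Hypothesis E_refl : reflexive_module E.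
Local Notation S := {mpoly K[n]}.

Lemma reflexive_torsion_free m (u : E) : 'X_[m] *: u = 0 -> u = 0.
Proof.
have [sep _] := E_refl => mu0; apply: sep => f.
have : f ('X_[m] *: u) = 0 by rewrite mu0 raddf0.
rewrite linearZ /= => /eqP; rewrite mulf_eq0 => /orP [/eqP X0|/eqP //].
by have /eqP := ev1X K m; rewrite X0 /ev1 meval0 eq_sym oner_eq0.
Qed.

Lemma mono_divides (a : 'X_{1..n}) (p : S) :
  (forall k, exists (m : 'X_{1..n}) q, (a k <= m k)%N /\ p = 'X_[m] * q) ->
  exists q, p = 'X_[a] * q.
Proof.
move=> hp; exists (\sum_(m <- msupp p) p@_m *: 'X_[m - a]).
rewrite [LHS]mpolyE mulr_sumr; apply: eq_big_seq => m mp.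
rewrite -scalerAr -mpolyXD addmC submK //; apply/mnm_lepP => k.
have [m' [q [am' ep]]] := hp k.
move: mp; rewrite ep mulrC (perm_mem (msuppMX _ _)) => /mapP [m'' _ ->].
by rewrite mnmDE; apply: leq_trans am' (leq_addr _ _).
Qed.

(** If [u] is divisible by the part of the monomial [x^(m - c)] in each single
    variable, it is divisible by the whole monomial: this holds in [S], hence
    for the values [f u] of all functionals, and [f |-> f u / x^(m - c)] is a
    functional on the dual, given by an element of [E]. *)
Lemma reflexive_glue c m (u : E) : zle c m -> gr m u ->
  (forall k, exists (c' : Zn n) (u' : E),
     [/\ c' k = c k, zle c' m & 'X_[mdiff c' m] *: u' = u]) ->
  exists2 w, gr c w & 'X_[mdiff c m] *: w = u.
Proof.
move=> cm um loc; have [sep bidual] := E_refl.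
have X_neq0 : 'X_[mdiff c m] != 0 :> S.
  by apply/eqP => X0; have /eqP := ev1X K (mdiff c m);
     rewrite X0 /ev1 meval0 eq_sym oner_eq0.
have dvd (f : {scalar E}) : exists q, f u = 'X_[mdiff c m] * q.
  apply: mono_divides => k; have [c' [u' [ck _ <-]]] := loc k.
  exists (mdiff c' m), (f u'); split; last by rewrite linearZ.
  by rewrite !mnmE ck.
have [Q QP] := functional_choice _ dvd.
have Qlin : dual_linear Q.
  move=> a f g h hE; apply: (mulfI X_neq0).
  by rewrite -QP mulrDr mulrCA -!QP hE.
have [w wP] := bidual Q Qlin.
have ew : 'X_[mdiff c m] *: w = u.
  apply/eqP; rewrite -subr_eq0; apply/eqP/sep => f.
  by rewrite linearB linearZ /= QP wP subrr.
have [||w' w'c ew'] := @gr_component _ _ _ _ (mnm_deg (mdiff c m))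
    (GRing.scale ('X_[mdiff c m] : S) : {additive E -> E}) c w.
- by move=> c' v; apply: grZ; apply: S_homogX.
- by rewrite /= ew mdiffK.
by exists w' => //; rewrite -[LHS]/(GRing.scale _ w') ew'.
Qed.

End Reflexive.

Lemma memv_bigcapP (K : fieldType) (V : vectType K) (I : finType) (U : I -> {vspace V}) v :
  reflect (forall i, v \in U i) (v \in (\bigcap_i U i)%VS).
Proof.
rewrite memvE; apply: (iffP subv_bigcapP) => h i; first by rewrite memvE h.
by move=> _; rewrite -memvE.
Qed.

Lemma subv_bigcap_seqP (K : fieldType) (V : vectType K) (I : eqType) (s : seq I)
    (U : {vspace V}) (W : I -> {vspace V}) :
  reflect (forall p, p \in s -> (U <= W p)%VS) (U <= \bigcap_(p <- s) W p)%VS.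
Proof.
rewrite big_tnth; apply: (iffP subv_bigcapP) => h p ps; last exact/h/mem_tnth.
by have /tnthP [l ->] : p \in in_tuple s by []; apply: h.
Qed.

Section Klyachko.
Variables (K : fieldType) (n : nat) (E : gmod K n) (F : nat -> gmod K n).
Variables (d : forall i, {linear F i.+1 -> F i}) (eps : {linear F 0%N -> E}).
Variables (b : nat -> Zn n -> nat) (co : forall i, coordinates (F i) (b i)).
Hypothesis res : minimal_graded_resolution d eps.
Variable del : forall i, 'Hom('rV[K]_(crk (co i.+1)), 'rV[K]_(crk (co i))).
Hypothesis delP : forall i u, del i (cev (co i.+1) u) = cev (co i) (d i u).
Hypothesis E_refl : reflexive_module E.
Variables (bE : vectType K) (iota : E -> bE).
Hypothesis colim : is_colimit iota.
Variable e0 : 'Hom('rV[K]_(crk (co 0)), bE).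
Hypothesis e0P : forall u, e0 (cev (co 0) u) = iota (eps u).
Variable Ef : 'I_n -> int -> {vspace bE}.
Hypothesis Ef_filt : is_klyachko_filtration iota Ef.

Lemma klyachko_mono k i j : i <= j -> (Ef k i <= Ef k j)%VS.
Proof.
move=> ij; apply/subvP => v /Ef_filt [c [u [ck uc <-]]]; apply/Ef_filt.
pose m : Zn n := [ffun l => if l == k then j else c l].
have cm : zle c m.
  by apply/zleP => l; rewrite ffunE; case: eqP => // ->; rewrite ck.
exists m, ('X_[mdiff c m] *: u); split; first by rewrite ffunE eqxx.
  exact: grX.
by apply: coconeX; case: colim.
Qed.

(** The generators of a cover of [E] bound the degrees of [E] from below. *)
Lemma klyachko_low : exists lo, forall k i, i < lo k -> Ef k i = 0%VS.
Proof.
have [s sP] := zle_bound [seq - cdeg j | j <- enum 'I_(crk (co 0))].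
exists (fun k => - s k) => k i ilo; apply/eqP; rewrite -subv0.
apply/subvP => v /Ef_filt [c [u [ck uc iu]]].
have /(e0_image res e0P) : exists2 u, gr c u & iota u = v by exists u.
rewrite /cspace (@eq_coordspace _ _ _ pred0) ?coordspace0 ?limg0 // => j.
apply/negP => /zleP /(_ k); rewrite ck => jk.
have /zleP /(_ k) := sP (- cdeg j) (map_f _ (mem_enum _ j)).
rewrite ffunE => jk'; move: ilo jk jk' => /=; lia.
Qed.

(** An element of the right-hand side comes, for each [k], from a degree with
    [k]-th entry [c k]; in a common larger degree [m] all these elements agree
    with one element, to which [reflexive_glue] applies. *)
Lemma klyachko_cspace c : (e0 @: cspace (co 0) c = \bigcap_k Ef k (c k))%VS.
Proof.
have iP : is_cocone iota by case: colim.
have inj := iota_inj res delP (reflexive_torsion_free E_refl) colim.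
apply/vspaceP => v; apply/idP/memv_bigcapP => [/(e0_image res e0P) [u uc iu] k|vE].
  by apply/Ef_filt; exists c, u.
apply/(e0_image res e0P).
have /fin_all_exists [c' c'P] k :
    exists c' : Zn n, exists u, [/\ c' k = c k, gr c' u & iota u = v].
  exact/Ef_filt.
have : v \in limg e0 by rewrite (e0_full res colim e0P) memvf.
case/memv_imgP => z _ ez; have [b1 hb1] := cspace_large z.
have [b2 hb2] := zle_bound [seq c' k | k <- enum 'I_n].
pose m := zmax c (zmax b1 b2).
have cm : zle c m := zmaxl _ _.
have [w wm ew] := cev_lift (hb1 m (zle_trans (zmaxl _ _) (zmaxr _ _))).
have iw : iota (eps w) = v by rewrite -e0P ew.
have [[egr _] _ _ _ _] := res.
have [|u uc eu] := @reflexive_glue _ _ _ E_refl c m (eps w) cm (egr _ _ wm).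
  move=> k; have [u [ck uc iu]] := c'P k.
  have c'm : zle (c' k) m.
    apply: zle_trans (zle_trans (zmaxr _ _) (zmaxr _ _)).
    by apply: hb2; apply: map_f; rewrite mem_enum.
  exists (c' k), u; split=> //; apply/eqP; rewrite -subr_eq0; apply/eqP.
  apply: (inj m); first by apply: grD; [exact: grX | apply/grN/egr].
  by rewrite coconeD // coconeN // coconeX // iu iw subrr.
by exists u => //; rewrite -iw -eu coconeX.
Qed.

End Klyachko.

Section Jumps.
Variables (K : fieldType) (n : nat) (bE : vectType K) (Ef : 'I_n -> int -> {vspace bE}).
Hypothesis mono : forall k i j, i <= j -> (Ef k i <= Ef k j)%VS.
Hypothesis low : exists lo, forall k i, i < lo k -> Ef k i = 0%VS.

(** Going down from [i], one meets either a jump or the zero steps. *)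
Lemma filtration_step k i : Ef k i = 0%VS \/
  exists j, [/\ j <= i, is_jump Ef k j & Ef k j = Ef k i].
Proof.
have [lo loP] := low.
have [N] : exists N : nat, i < lo k + N%:Z by exists `|i - lo k|.+1; lia.
elim: N i => [|N IH] i iN; first by left; apply: loP; rewrite addr0 in iN.
have [e|ne] := eqVneq (Ef k (i - 1)) (Ef k i); last first.
  by right; exists i; split=> //; split; [apply: mono; lia | exact/eqP].
rewrite -e; have [|->|[j [ji jj ej]]] := IH (i - 1); first by lia.
  by left.
by right; exists j; split=> //; lia.
Qed.

End Jumps.

(** * The Koszul numbers of a resolution *)

Section KoszulOfResolution.
Variables (K : fieldType) (n : nat) (F : nat -> gmod K n).
Variables (b : nat -> Zn n -> nat) (co : forall i, coordinates (F i) (b i)).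
Variable del : forall i, 'Hom('rV[K]_(crk (co i.+1)), 'rV[K]_(crk (co i))).
Variables (V : vectType K) (e1 : 'Hom('rV[K]_(crk (co 0)), V)).
Hypothesis del_del : forall i v, del i (del i.+1 v) = 0.
Hypothesis del_cspace : forall i c,
  (del i @: cspace (co i.+1) c <= cspace (co i) c)%VS.
Hypothesis del_exact : forall i c,
  (cspace (co i.+1) c :&: lker (del i) <= del i.+1 @: cspace (co i.+2) c)%VS.
Hypothesis del_minimal : forall i c v (j : 'I_(crk (co i))),
  v \in cspace (co i.+1) c -> cdeg j = c -> del i v 0 j = 0.
Hypothesis e1_ker : forall c,
  (cspace (co 0) c :&: lker e1 = del 0 @: cspace (co 1) c)%VS.
Variable c : Zn n.
Implicit Types (A B : {set 'I_n}) (k : 'I_n).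

Definition lower B : Zn n := [ffun k => c k - (k \in B)%:R].

Lemma zle_lowerU a A B : zle a (lower (A :|: B)) = zle a (lower A) && zle a (lower B).
Proof.
apply/zleP/andP => [h|[/zleP hA /zleP hB] k].
  by split; apply/zleP => k; have := h k; rewrite !ffunE inE;
     case: (k \in A); case: (k \in B) => /=; lia.
by have := hA k; have := hB k; rewrite !ffunE inE; case: (k \in A).
Qed.

Let rows (i : nat) : vectType K := 'rV[K]_(crk (co i)).
Let subcpx := @subcomplex K rows del.

Definition cube B i := cspace (co i) (lower B).
Definition cubesum A B i := (\sum_(k in A) cube (k |: B) i)%VS.

(** [dim Tor_i(E, S / (x_k : k in A))] in degree [c - e_B]: the homology of the
    resolution modulo the variables in [A]. *)
Definition torh i A B := @relhom K rows del (cube B) (cubesum A B) i.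

Lemma cubesumE A B i :
  cubesum A B i =
  coordspace K (fun j : 'I_(crk (co i)) =>
    [exists k in A, zle (cdeg j) (lower (k |: B))]).
Proof. exact: coordspace_bigU. Qed.

Lemma cubeU k B i : (cube (k |: B) i <= cube B i)%VS.
Proof. by apply: coordspaceS => j; rewrite /cle zle_lowerU => /andP []. Qed.

Lemma cubesum_le A B i : (cubesum A B i <= cube B i)%VS.
Proof. by apply/subv_sumP => k _; apply: cubeU. Qed.

Lemma subcomplex_cube B : subcpx (cube B).
Proof. by move=> i; apply: del_cspace. Qed.

Lemma subcomplex_cubesum A B : subcpx (cubesum A B).
Proof.
move=> i; rewrite /cubesum limg_sum; apply/subv_sumP => k kA.
by rewrite (subv_trans (subcomplex_cube _ _)) // (sumv_sup k).
Qed.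

(** Adding [x_k] to [A] is the long exact sequence for the subcomplex of degree
    [c - e_B - e_k]; the subcomplexes are spanned by coordinate vectors, so
    their sums and intersections distribute. *)
Lemma koszul_numbers_tor : koszul_numbers (fun B => e1 @: cube B 0)%VS torh.
Proof.
split=> [A B|i B|A B k].
- rewrite /torh /=; set N := (del 0 @: _)%VS; set Q := cubesum A B 0.
  have -> : (\sum_(k in A) e1 @: cube (k |: B) 0 = e1 @: Q)%VS by rewrite limg_sum.
  have eN : N = (cube B 0 :&: lker e1)%VS by rewrite e1_ker.
  have NB : (N + Q <= cube B 0)%VS by rewrite subv_add eN capvSl cubesum_le.
  have := limg_ker_dim e1 (cube B 0); have := limg_ker_dim e1 (N + Q).
  have -> : ((N + Q) :&: lker e1)%VS = N.
    apply/eqP; rewrite eqEsubv; apply/andP; split; first by rewrite {2}eN capvS.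
    by rewrite subv_cap addvSl {1}eN capvSr.
  have -> : (e1 @: (N + Q) = e1 @: Q)%VS.
    rewrite limgD (_ : e1 @: N = 0)%VS ?add0v //.
    by apply/eqP; rewrite -lkerE eN capvSr.
  by rewrite -eN => <- <-; rewrite subnDl.
- rewrite /torh /= (_ : cubesum set0 B i = 0%VS); last exact: big_set0.
  rewrite lpreim0; apply/eqP; rewrite subn_eq0; apply: dimvS.
  exact: subv_trans (del_exact _ _) (addvSl _ _).
have eP i : cubesum (k |: A) B i = (cube (k |: B) i + cubesum A B i)%VS.
  rewrite !cubesumE coordspaceU; apply: eq_coordspace => j.
  apply/esym; apply/orP/existsP => [[h|/existsP [k' /andP [k'A h]]]|[k']].
  - by exists k; rewrite setU11.
  - by exists k'; rewrite setU1r.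
  rewrite !inE => /andP [/orP [/eqP ->|k'A] h]; first by left.
  by right; apply/existsP; exists k'; rewrite k'A.
have eI i : cubesum A (k |: B) i = (cube (k |: B) i :&: cubesum A B i)%VS.
  rewrite !cubesumE coordspaceI; apply: eq_coordspace => j /=.
  apply/esym; apply/andP/existsP => [[h /existsP [k' /andP [k'A h']]]|[k' /andP [k'A]]].
    exists k'; rewrite k'A setUCA zle_lowerU.
    by rewrite h' andbT; move: h; rewrite /cle zle_lowerU => /andP [].
  rewrite setUCA zle_lowerU => /andP [h h']; split.
    by move: h'; rewrite /cle !zle_lowerU h => /andP [].
  by apply/existsP; exists k'; rewrite k'A.
exact: (@relhom_les K rows del del_del _ _ _ _ _ (subcomplex_cube B)
  (subcomplex_cube (k |: B)) (subcomplex_cubesum A B) (cubeU k B) (cubesum_le A B) eP eI).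
Qed.

Lemma zle_lower a :
  [exists k in setT, zle a (lower (k |: set0))] = zle a c && (a != c).
Proof.
apply/existsP/andP => [[k /andP [_ /zleP ak]]|[/zleP ac nac]].
  split; first by apply/zleP => k'; have := ak k'; rewrite ffunE; case: (_ \in _) => /=; lia.
  by apply/eqP => e; have := ak k; rewrite e ffunE setU11 /=; lia.
have /existsP [k nk] : [exists k, a k != c k].
  apply: contraR nac => /existsPn h; apply/eqP/ffunP => k.
  by apply/eqP; have := h k; rewrite negbK.
exists k; rewrite inE; apply/zleP => k'; rewrite ffunE !inE orbF.
have := ac k'; move: nk; case: (k' =P k) => [->|_] /=; lia.
Qed.

(** By minimality the differential vanishes modulo the variables, so only the
    generators of degree exactly [c] have to be counted. *)
Lemma tor_betti i : torh i setT set0 = b i c.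
Proof.
have l0 : lower set0 = c by apply/ffunP => k; rewrite ffunE inE subr0.
have delQ j : (del j @: cube set0 j.+1 <= cubesum setT set0 j)%VS.
  apply/subvP => w /memv_imgP [v vC ->]; rewrite cubesumE; apply/coordspaceP => l dl.
  have /coordspaceP /(_ l dl) : del j v \in cube set0 j.
    by apply: (subvP (subcomplex_cube set0 j)); rewrite memv_img.
  rewrite /cle zle_lower l0 => -> /=; move: vC; rewrite /cube l0 => vC.
  by apply: contraNneq dl => lc'; apply/eqP/(del_minimal vC lc').
have -> : torh i setT set0 = (\dim (cube set0 i) - \dim (cubesum setT set0 i))%N.
  rewrite /torh; case: i => [|i] /=.
    by congr subn; apply: congr1; apply/addv_idPr/delQ.
  congr subn; apply: congr1; last exact/addv_idPr/delQ.
  apply/capv_idPl/subvP => v vC; rewrite -memv_preim; apply: (subvP (delQ i)).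
  exact: memv_img.
rewrite cubesumE !dim_coordspace (cev_count (co i)).
have -> : #|@cle _ _ _ _ (co i) (lower set0)| =
    (#|[pred j : 'I_(crk (co i)) | zle (cdeg j) c && (cdeg j != c)]| +
     #|[pred j : 'I_(crk (co i)) | cdeg j == c]|)%N.
  rewrite l0 -(cardID [pred j | cdeg j != c]); congr addn; apply: eq_card => j.
  rewrite !inE negbK -[_ \in _]/(zle _ _).
  by case: eqP => //= ->; apply: zle_refl.
have -> : #|fun j : 'I_(crk (co i)) => [exists k in setT, zle (cdeg j) (lower (k |: set0))]| =
    #|[pred j : 'I_(crk (co i)) | zle (cdeg j) c && (cdeg j != c)]|.
  by apply: eq_card => j; apply: zle_lower.
by rewrite addKn.
Qed.

End KoszulOfResolution.

(** * Families of flats containing all hyperplanes *)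

Section ArrangementKoszul.
Variables (K : fieldType) (V : vectType K) (t : nat) (H : 'I_t -> {vspace V}).
Hypotheses (H_hyp : hyperplanes H) (H_ess : essential H).

Lemma flatsP (X : {vspace V}) :
  reflect (exists A : {set 'I_t}, X = (\bigcap_(l in A) H l)%VS) (X \in flats H).
Proof.
rewrite mem_undup; apply: (iffP mapP) => [[A _ ->]|[A ->]]; first by exists A.
by exists A; rewrite ?mem_enum.
Qed.

Lemma flats0 : 0%VS \in flats H.
Proof.
apply/flatsP; exists setT; rewrite -H_ess.
by apply: eq_bigl => l; rewrite inE.
Qed.

Lemma flat_cut (X : {vspace V}) l : X \in flats H -> ~~ (X <= H l)%VS ->
  (X :&: H l)%VS \in flats H /\ (\dim (X :&: H l)).+1 = \dim X.
Proof.
move=> /flatsP [A eX] nXl; split.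
  apply/flatsP; exists (l |: A); rewrite big_setU1 /=; first by rewrite -eX capvC.
  by apply: contra nXl => lA; rewrite eX (bigcapv_inf l).
have := dimv_sum_cap X (H l); have := H_hyp l.
have : (\dim (X + H l) <= \dim {:V})%N by apply: dimvS; rewrite subvf.
have : (\dim (H l) < \dim (X + H l))%N.
  rewrite ltn_neqAle dimvS ?addvSr // andbT (dimv_leqif_eq (addvSr _ _)).
  by apply: contra nXl => /eqP ->; rewrite addvSl.
lia.
Qed.

Lemma flat_below (X Y : {vspace V}) : X \in flats H -> Y \in flats H ->
  (Y <= X)%VS -> Y != X -> exists l, ~~ (X <= H l)%VS /\ (Y <= X :&: H l)%VS.
Proof.
move=> Xf /flatsP [A eY] YX nYX.
have /existsP [l /andP [lA nXl]] : [exists l, (l \in A) && ~~ (X <= H l)%VS].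
  apply: contraR nYX => /existsPn h; rewrite eqEsubv YX eY; apply/subv_bigcapP => l lA.
  by have := h l; rewrite lA negbK.
by exists l; split=> //; rewrite subv_cap YX eY (bigcapv_inf l).
Qed.

Variables (T : finType) (U : {set T} -> {vspace V}).
Variable h : nat -> {set T} -> {set T} -> nat.
Hypothesis hU : forall A B, (U (A :|: B) = U A :&: U B)%VS.
Hypothesis hK : koszul_numbers U h.
Hypothesis Uf : forall A, U A \in flats H.
Local Notation X := (U set0).
Hypothesis neU : X != 0%VS -> forall k, U [set k] != X.
Hypothesis cov : forall Y, Y \in flats H -> (Y <= X)%VS -> Y != X ->
  exists k, (Y <= U [set k])%VS.

Let UX A : (U A <= X)%VS. Proof. by rewrite -(set0U A) hU capvSl. Qed.

Let flat_hyper Y : X != 0%VS -> Y \in flats H -> (Y <= X)%VS -> Y != X ->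
  exists2 k, hyper U k set0 & (Y <= U [set k])%VS.
Proof.
move=> X0 Yf YX nYX; have [l [nXl Yl]] := flat_below (Uf set0) Yf YX nYX.
have [Zf dimZ] := flat_cut (Uf set0) nXl.
have nZX : (X :&: H l)%VS != X.
  by apply: contra nXl => /eqP/capv_idPl.
have [k Zk] := cov Zf (capvSl _ _) nZX; exists k; last exact: subv_trans Yl Zk.
rewrite /hyper setU0; apply/eqP; rewrite eqn_leq -{2}dimZ ltnS dimvS // andbT.
by rewrite ltn_neqAle dimvS ?UX // andbT (dimv_leqif_eq (UX _)) neU.
Qed.

(** [A0] collects the hyperplanes of [X] in the family.  As every
    [X :&: H l] different from [X] is among them, they intersect in 0 by
    essentiality, so their rank is [dim X]. *)
Lemma koszul_arrangement_concentration i : \dim X <> i.+1 -> h i setT set0 = 0%N.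
Proof.
move=> ne; have [X0|Xn0] := eqVneq X 0%VS.
  have [T0|[k _]] := set_0Vmem (setT : {set T}); last first.
    apply: (koszul_acyclic hU hK) (in_setT k) _.
    by apply/eqP; rewrite X0 -subv0 -X0 UX.
  rewrite T0; case: hK => h0 hS _; case: i {ne} => [|i]; last exact: hS.
  by rewrite h0 X0 dimv0.
pose A0 := [set k | (\dim (U (k |: set0))).+1 == \dim X].
have hyp k : k \in A0 -> hyper U k set0 by rewrite inE => /eqP.
have A0P k : hyper U k set0 -> k \in A0 by move=> /eqP; rewrite inE.
have dom Y : Y \in flats H -> (Y <= X)%VS -> Y != X ->
    exists2 k, k \in A0 & (Y <= U [set k])%VS.
  by move=> Yf YX nYX; have [k /A0P kA Yk] := flat_hyper Xn0 Yf YX nYX; exists k.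
have UA0 : U A0 = 0%VS.
  apply/eqP; rewrite -subv0 -H_ess; apply/subv_bigcapP => l _.
  have [Xl|nXl] := boolP (X <= H l)%VS; first exact: subv_trans (UX _) Xl.
  have [Zf dimZ] := flat_cut (Uf set0) nXl.
  have nZX : (X :&: H l)%VS != X by apply: contra nXl => /eqP/capv_idPl.
  have [k kA Zk] := dom _ Zf (capvSl _ _) nZX.
  have eZ : (X :&: H l)%VS = U [set k].
    apply/eqP; rewrite eqEdim Zk /= -ltnS dimZ.
    by have := hyp k kA; rewrite /hyper setU0 => ->.
  apply: subv_trans (capvSr X _); rewrite eZ.
  by rewrite -(setD1K kA) hU capvSl.
have [k0 k0A _] : exists2 k, k \in A0 & (0 <= U [set k])%VS.
  by apply: (dom 0%VS); rewrite ?flats0 ?sub0v // eq_sym.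
apply: (koszul_concentration hU hK (subsetT A0)) => //.
- by apply/set0Pn; exists k0.
- move=> k _; have [j jA kj] := dom _ (Uf [set k]) (UX _) (neU Xn0 k).
  by exists j => //; rewrite !setU0.
- by rewrite setU0 UA0 dimv0 subn0.
Qed.

Lemma koszul_arrangement_beta i : \dim X = i.+1 ->
  (h i setT set0)%:Z = beta_invariant H X.
Proof.
move=> dX; rewrite /beta_invariant dX /=.
have Xn0 : X != 0%VS by rewrite -dimv_eq0 dX.
rewrite -(crosscut hU Uf (neU Xn0) cov).
have e := koszul_euler hK (N := #|T|.+1 + i.+1) (A := setT) set0.
have {e} : \sum_(j < #|T|.+1 + i.+1) (-1) ^+ j * (h j setT set0)%:Z =
    \sum_(A : {set T}) (-1) ^+ #|A| * (\dim (U A))%:Z.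
  rewrite e ?cardsT ?ltn_addr //; apply: eq_big => A; first by rewrite subsetT.
  by rewrite setU0.
have lt : (i < #|T|.+1 + i.+1)%N by rewrite addnS ltnS leq_addl.
rewrite (bigD1 (Ordinal lt)) //= big1 ?addr0 => [<-|j nj]; last first.
  rewrite koszul_arrangement_concentration ?mulr0 // dX => -[ij].
  by case/eqP: nj; apply: val_inj.
by rewrite mulrA -expr2 sqrr_sign mul1r.
Qed.

End ArrangementKoszul.

(** * The family attached to a flat of a reflexive model *)

Section ReflexiveModel.
Variables (K : fieldType) (V : vectType K) (t : nat) (H : 'I_t -> {vspace V}).
Hypothesis H_ess : essential H.
Variables (n : nat) (bE : vectType K) (Ef : 'I_n -> int -> {vspace bE}).
Variable phi : 'Hom(bE, V).
Hypothesis phi_model : identifies_flats H Ef phi.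
Hypothesis mono : forall k i j, i <= j -> (Ef k i <= Ef k j)%VS.
Hypothesis low : exists lo, forall k i, i < lo k -> Ef k i = 0%VS.
Variable c : Zn n.
Implicit Types (A B : {set 'I_n}) (k : 'I_n).

Definition model_cube A : {vspace V} := (phi @: \bigcap_k Ef k (lower c A k))%VS.

Let phi0 : lker phi == 0%VS. Proof. by case: phi_model => ->. Qed.

Let lower0 : lower c set0 = c.
Proof. by apply/ffunP => k; rewrite ffunE inE subr0. Qed.

Lemma model_cubeU A B : (model_cube (A :|: B) = model_cube A :&: model_cube B)%VS.
Proof.
rewrite /model_cube -lker0_img_cap //; congr (_ @: _)%VS; apply/vspaceP => v.
rewrite memv_cap; apply/memv_bigcapP/andP => [h|[/memv_bigcapP hA /memv_bigcapP hB] k].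
  by split; apply/memv_bigcapP => k; apply: (subvP (mono _ _)) (h k);
     rewrite !ffunE inE; case: (k \in A); case: (k \in B) => /=; lia.
by have := hA k; have := hB k; rewrite !ffunE inE; case: (k \in A).
Qed.

(** A filtration step before the first jump is 0, which is a flat because the
    arrangement is essential. *)
Lemma model_cube_flat A : model_cube A \in flats H.
Proof.
have [_ _ fl] := phi_model.
have [/existsP [k /eqP Ek0]|/existsPn En0] := boolP [exists k, Ef k (lower c A k) == 0%VS].
  rewrite (_ : model_cube A = 0%VS) ?flats0 //; apply/eqP.
  rewrite -subv0 -(limg0 phi) limgS //; apply/subvP => v /memv_bigcapP /(_ k).
  by rewrite Ek0.
have /fin_all_exists [j jP] k : exists j, is_jump Ef k j /\ Ef k j = Ef k (lower c A k).
  have [e|[j [_ jj ej]]] := filtration_step mono low k (lower c A k); last by exists j.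
  by have := En0 k; rewrite e eqxx.
apply/fl; exists (\bigcap_k Ef k (lower c A k))%VS; split=> //.
exists [seq (k, j k) | k <- enum 'I_n]; split.
  by move=> p /mapP [k _ ->]; case: (jP k).
rewrite big_map big_enum; apply: eq_bigr => k _ /=; by case: (jP k).
Qed.

Variable X : {vspace V}.
Hypotheses (X_flat : X \in flats H) (c_X : is_poset_embedding Ef phi X c).

(** [X] is an intersection of filtration steps, each of which contains the step
    at [c]. *)
Lemma model_cube0 : model_cube set0 = X.
Proof.
have [_ _ fl] := phi_model; rewrite /model_cube lower0.
have /fl [W [[s [sj eW]] eX]] := X_flat.
apply/eqP; rewrite eqEsubv eX; apply/andP; split.
  apply/limgS; rewrite eW; apply/subv_bigcap_seqP => p ps.
  have [_ _ cmin] := c_X p.1.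
  have cp : c p.1 <= p.2.
    apply: cmin; first exact: sj.
    by rewrite eX limgS // eW; apply: (subv_bigcap_seqP _ _ _ (subvv _)).
  by apply/subvP => v /memv_bigcapP /(_ p.1); apply: (subvP (mono _ cp)).
apply/limgS/subv_bigcapP => k _; have [_ Xk _] := c_X k.
by rewrite -(limg_ker0 _ _ phi0) -eX.
Qed.

Lemma model_cube1 k : model_cube [set k] = (X :&: phi @: Ef k (c k - 1))%VS.
Proof.
rewrite -model_cube0 /model_cube lower0 -lker0_img_cap //; congr (_ @: _)%VS.
apply/vspaceP => v; rewrite memv_cap; apply/memv_bigcapP/andP => [h|[/memv_bigcapP h vk] k'].
  split; last by have := h k; rewrite ffunE inE eqxx.
  apply/memv_bigcapP => k'; apply: (subvP (mono _ _)) (h k').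
  by rewrite ffunE; case: (_ \in _) => /=; lia.
by rewrite ffunE inE; case: eqP => [->|_] //=; rewrite subr0.
Qed.

(** Otherwise [X] would be contained in the last jump below [c k],
    contradicting the minimality of [c k], or in the zero part of the
    filtration. *)
Lemma model_cube1_neq k : X != 0%VS -> model_cube [set k] != X.
Proof.
move=> X0; rewrite model_cube1; apply: contra X0 => /eqP/capv_idPl Xk.
have [e|[j [jc jj ej]]] := filtration_step mono low k (c k - 1).
  by move: Xk; rewrite e limg0 subv0.
have [_ _ cmin] := c_X k.
have := cmin j jj; rewrite ej => /(_ Xk); lia.
Qed.

(** Some filtration step through [Y] does not contain [X]; it therefore comes
    before [c k], so it lies in the step at [c k - 1]. *)
Lemma model_cube1_cover Y : Y \in flats H -> (Y <= X)%VS -> Y != X ->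
  exists k, (Y <= model_cube [set k])%VS.
Proof.
have [_ _ fl] := phi_model.
move=> /fl [W [[s [sj eW]] eY]] YX nYX.
have Ws p : p \in s -> (W <= Ef p.1 p.2)%VS.
  by rewrite eW; apply: (subv_bigcap_seqP _ _ _ (subvv _)).
have /hasP [p ps nXp] : has (fun p => ~~ (X <= phi @: Ef p.1 p.2)%VS) s.
  apply: contraR nYX; rewrite -all_predC => /allP h; rewrite eqEsubv YX /=.
  have eX : (phi @: (phi @^-1: X))%VS = X.
    by apply: lpreimK; have [_ -> _] := phi_model; apply: subvf.
  rewrite eY -eX limgS // eW; apply/subv_bigcap_seqP => p /h /=; rewrite negbK => Xp.
  by rewrite -(limg_ker0 _ _ phi0) eX.
have [_ Xc _] := c_X p.1; exists p.1; rewrite model_cube1 subv_cap YX eY limgS //.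
apply: subv_trans (Ws p ps) (mono _ _).
have : ~~ (c p.1 <= p.2).
  apply: contra nXp => cp; apply: subv_trans Xc _; exact/limgS/mono.
rewrite -ltNge; lia.
Qed.

End ReflexiveModel.

Unset Implicit Arguments.

Theorem theorem4p5 (K : fieldType) (V : vectType K)
  (t : nat) (H : 'I_t -> {vspace V})
  (H_hyp : hyperplanes H) (H_ess : essential H)
  (n : nat) (E : gmod K n)
  (E_fg : fin_generated E) (E_refl : reflexive_module E)
  (bE : vectType K) (iota : E -> bE) (iota_colim : is_colimit iota)
  (Ef : 'I_n -> int -> {vspace bE}) (Ef_filt : is_klyachko_filtration iota Ef)
  (phi : 'Hom(bE, V)) (phi_model : identifies_flats H Ef phi)
  (beta : nat -> Zn n -> nat) (beta_betti : graded_betti E beta)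
  (X : {vspace V}) (X_flat : X \in flats H)
  (c : Zn n) (c_X : is_poset_embedding Ef phi X c) (i : nat) :
  (\dim X <> i.+1 -> beta i c = 0%N) /\
  (\dim X = i.+1 -> (beta i c)%:Z = beta_invariant H X).
Proof.
have [F [d [eps [res free]]]] := beta_betti.
have co i' : coordinates (F i') (beta i').
  apply: (proj1_sig (constructive_indefinite_description (fun=> True) _)).
  by have [co] := graded_free_coordinates (free i'); exists co.
have evP i' := cev_cocone (co i').
have [del delP] : exists del : forall i', 'Hom('rV[K]_(crk (co i'.+1)), 'rV[K]_(crk (co i'))),
    forall i' u, del i' (cev (co i'.+1) u) = cev (co i') (d i' u).
  have fac i' : exists g : 'Hom('rV[K]_(crk (co i'.+1)), 'rV[K]_(crk (co i'))),
      forall u, g (cev (co i'.+1) u) = cev (co i') (d i' u).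
    apply: cev_factor; have [eD eC eX] := evP i'.
    by split=> *; rewrite ?linearD ?linearZ /= ?eD ?eC ?eX.
  exists (fun i' => proj1_sig (constructive_indefinite_description _ (fac i'))) => i'.
  exact: proj2_sig (constructive_indefinite_description _ (fac i')).
have [e0 e0P] : exists g : 'Hom('rV[K]_(crk (co 0%N)), bE),
    forall u, g (cev (co 0%N) u) = iota (eps u).
  apply: cev_factor; have [[eD eC eX] _] := iota_colim.
  by split=> *; rewrite ?linearD ?linearZ /= ?eD ?eC ?eX.
have E_tf := reflexive_torsion_free E_refl.
have mono := klyachko_mono iota_colim Ef_filt.
have low := klyachko_low res e0P Ef_filt.
have phi0 : lker phi == 0%VS by case: phi_model => ->.
pose e1 := (phi \o e0)%VF.
have e1_ker c' : (cspace (co 0%N) c' :&: lker e1 = del 0%N @: cspace (co 1%N) c')%VS.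
  rewrite -(e0_ker res delP E_tf iota_colim e0P); congr (_ :&: _)%VS.
  apply/vspaceP => v; rewrite !memv_ker comp_lfunE.
  by rewrite -(raddf0 phi) (inj_eq (lker0P phi0)).
have hK := koszul_numbers_tor (del_del res delP) (del_cspace res delP)
  (del_exact res delP) e1_ker c.
have eU : (fun B => e1 @: cube co c B 0%N)%VS =1 model_cube Ef phi c.
  move=> B; rewrite /model_cube limg_comp; congr (_ @: _)%VS.
  exact: (klyachko_cspace res delP E_refl iota_colim e0P Ef_filt).
have {}hK : koszul_numbers (model_cube Ef phi c) (torh del c).
  have [h0 hS les] := hK; split=> // A B; rewrite h0 eU; congr (_ - \dim _)%N.
  by apply: eq_bigr => k _; apply: eU.
have hU := model_cubeU phi_model mono c.
have Uf := model_cube_flat H_ess phi_model mono low c.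
have U0 := model_cube0 phi_model mono X_flat c_X.
have neU : model_cube Ef phi c set0 != 0%VS ->
    forall k, model_cube Ef phi c [set k] != model_cube Ef phi c set0.
  by rewrite U0 => X0 k; apply: (model_cube1_neq phi_model mono low X_flat c_X).
have cov Y : Y \in flats H -> (Y <= model_cube Ef phi c set0)%VS ->
    Y != model_cube Ef phi c set0 -> exists k, (Y <= model_cube Ef phi c [set k])%VS.
  by rewrite U0; apply: (model_cube1_cover phi_model mono X_flat c_X).
rewrite -(tor_betti (del_cspace res delP) (del_minimal res delP) c i) -U0.
split; first exact: (koszul_arrangement_concentration H_hyp H_ess hU hK Uf neU cov).
exact: (koszul_arrangement_beta H_hyp H_ess hU hK Uf neU cov).
Qed.
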